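(* Let $G=(V,E)$ be a sorted DAG, $\mu\in\mathcal P_G(\mathcal X)$, $\nu\in\mathcal P(\mathcal Y)$ and $\pi\in\Pi(\mu,\nu)$. Then the following are equivalent: (i) $\pi\in\Pi_G(\mu,\nu)$; (ii) for $(X,Y)\sim\pi$, $Y_i\perp\!\!\!\perp_{(X_i,X_{\mathrm{pa}_i},Y_{\mathrm{pa}_i})}(X,Y_{1:i-1})$ for all $i=1,\dots,n$; (iii) for $(X,Y)\sim\pi$, $X_i\perp\!\!\!\perp_{X_{\mathrm{pa}_i}}(X_{1:i-1},Y_{1:i-1})$ and $Y_i\perp\!\!\!\perp_{(X_i,X_{\mathrm{pa}_i},Y_{\mathrm{pa}_i})}(X_{1:i},Y_{1:i-1})$ for all $i=1,\dots,n$; (iv) $\pi$ is jointly $G$-compatible, i.e. $\pi(dx_1,dy_1,\dots,dx_n,dy_n)=\bigotimes_{i=1}^n\pi(dx_i,dy_i\mid x_{\mathrm{pa}_i},y_{\mathrm{pa}_i})$, and moreover $\pi(dx_i\mid x_{\mathrm{pa}_i},y_{\mathrm{pa}_i})=\mu(dx_i\mid x_{\mathrm{pa}_i})$ for all $i=1,\dots,n$ and $\pi$-almost all $(x,y)$.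
   Context: Let $n\in\mathbb N$, $V=\{1,\dots,n\}$ and $G=(V,E)$ a directed graph with $E\subseteq\{(i,j)\in V\times V: i\neq j\}$. For $j\in V$ let $\mathrm{pa}_j=\{i\in V:(i,j)\in E\}$ (ordered increasingly). $G$ is a sorted DAG if every $(i,j)\in E$ satisfies $i<j$. Let $\mathcal X=\mathcal X_1\times\cdots\times\mathcal X_n$, $\mathcal Y=\mathcal Y_1\times\cdots\times\mathcal Y_n$ with non-empty Polish spaces $\mathcal X_i,\mathcal Y_i$, product topologies and Borel $\sigma$-algebras; $\mathcal P(\cdot)$ denotes Borel probability measures and $\Pi(\mu,\nu)$ the set of couplings of $\mu\in\mathcal P(\mathcal X)$ and $\nu\in\mathcal P(\mathcal Y)$. For an ordered subset $A\subseteq V$ write $x_A=(x_i)_{i\in A}$, $\mathcal X_A=\prod_{i\in A}\mathcal X_i$, $x_{1:i}=(x_1,\dots,x_i)$, $x_{1:0}=\emptyset$. $S\perp\!\!\!\perp_Z W$ means $\mathbb P[S\in A,W\in B\mid Z]=\mathbb P[S\in A\mid Z]\,\mathbb P[W\in B\mid Z]$ a.s. for all measurable $A,B$. For a sorted DAG $G$, $\mu\in\mathcal P(\mathcal X)$ is $G$-compatible if for $X\sim\mu$, $X_i\perp\!\!\!\perp_{X_{\mathrm{pa}_i}}X_{1:i-1}$ for all $i=2,\dots,n$; equivalently $\mu(dx)=\bigotimes_{i=1}^n\mu(dx_i\mid x_{\mathrm{pa}_i})$ with $\mu(dx_i\mid x_{\mathrm{pa}_i})$ a regular conditional distribution of $X_i$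 given $X_{\mathrm{pa}_i}$; $\mathcal P_G(\mathcal X)$ is the set of such measures. A coupling $\pi\in\Pi(\mu,\nu)$ is $G$-causal if there exist, on some probability space, random variables $(X,Y)\sim\pi$, measurable maps $g_i:\mathcal X_i\times\mathcal X_{\mathrm{pa}_i}\times\mathcal Y_{\mathrm{pa}_i}\times\mathbb R\to\mathcal Y_i$ and real random variables $U_1,\dots,U_n$ such that $X,U_1,\dots,U_n$ are independent and $Y_i=g_i(X_i,X_{\mathrm{pa}_i},Y_{\mathrm{pa}_i},U_i)$ for all $i=1,\dots,n$. $\Pi_G(\mu,\nu)$ denotes the set of $G$-causal couplings. Conditional kernels $\pi(\cdot\mid\cdot)$ denote regular conditional distributions under $\pi$ of the indicated coordinates given the indicated coordinates. *)

(* Defs.v *)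
From HB Require Import structures.
From mathcomp Require Import all_boot all_order all_algebra.
From mathcomp Require Import all_classical all_reals all_analysis.
From mathcomp Require Import measurable_realfun.
Import GRing.Theory Num.Theory.
Local Open Scope classical_set_scope.
Local Open Scope ring_scope.

Definition polish (R : realType) (T : topologicalType) : Prop :=
  (exists D : set T, countable D /\ closure D = setT) /\
  exists dist : T -> T -> R,
    [/\ (forall x y, dist x y = 0 <-> x = y),
        (forall x y, dist x y = dist y x),
        (forall x y z, dist x z <= dist x y + dist y z),
        (forall A : set T, open A <->
           (forall x, A x -> exists2 e : R, 0 < e & [set y | dist x y < e] `<=` A)) &
        (forall u : nat -> T,
           (forall e : R, 0 < e -> exists N : nat, forall m k : nat,
               (N <= m)%N -> (N <= k)%N -> dist (u m) (u k) < e) ->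
           exists l : T, forall e : R, 0 < e -> exists N : nat, forall m : nat,
               (N <= m)%N -> dist (u m) l < e)].

Definition Borel (T : ptopologicalType) := g_sigma_algebraType (@open T).

Definition dprod {I : Type} (T : I -> ptopologicalType) := forall i, T i.

Definition dprod_gen {I : Type} (T : I -> ptopologicalType) : set (set (dprod T)) :=
  [set A | exists i (B : set (T i)), <<s @open (T i) >> B /\
                                     A = (fun x : dprod T => x i) @^-1` B].

Definition DProd {I : Type} (T : I -> ptopologicalType) :=
  g_sigma_algebraType (dprod_gen T).

Definition Isub {n : nat} (S : {set 'I_n}) := {j : 'I_n | j \in S}.
Definition fam {n : nat} (T : 'I_n -> ptopologicalType) (S : {set 'I_n}) :
  Isub S -> ptopologicalType := fun j => T (val j).
Definition dsub {n : nat} {T : 'I_n -> ptopologicalType} (S : {set 'I_n})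
  (x : DProd T) : DProd (fam T S) := fun j => x (val j).

(* index sets (0-based: index i here is index i+1 of the paper) *)
Definition lt_set {n : nat} (i : 'I_n) : {set 'I_n} := [set j : 'I_n | (j < i)%N].
Definition le_set {n : nat} (i : 'I_n) : {set 'I_n} := [set j : 'I_n | (j <= i)%N].

Definition sorted_dag {n : nat} (E : rel 'I_n) : Prop :=
  forall i j, E i j -> (i < j)%N.

Definition pa {n : nat} (E : rel 'I_n) (j : 'I_n) : {set 'I_n} :=
  [set i : 'I_n | E i j].

Section condprob.
Context {R : realType} {d : measure_display} {Omega : measurableType d}.
Variable P : probability Omega R.

Definition cprob_version {dZ : measure_display} {TZ : measurableType dZ}
    (Z : Omega -> TZ) (E : set Omega) (h : TZ -> R) : Prop :=
  [/\ measurable_fun setT h,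
      P.-integrable setT (EFin \o (h \o Z)) &
      forall C : set TZ, measurable C ->
        (\int[P]_(w in Z @^-1` C) (h (Z w))%:E = P (E `&` Z @^-1` C))%E].

Definition cond_indep {dS dW dZ : measure_display} {TS : measurableType dS}
    {TW : measurableType dW} {TZ : measurableType dZ}
    (S : Omega -> TS) (W : Omega -> TW) (Z : Omega -> TZ) : Prop :=
  forall (A : set TS) (B : set TW), measurable A -> measurable B ->
    exists hA hB hAB : TZ -> R,
      [/\ cprob_version Z (S @^-1` A) hA,
          cprob_version Z (W @^-1` B) hB,
          cprob_version Z (S @^-1` A `&` W @^-1` B) hAB &
          {ae P, forall w, hAB (Z w) = hA (Z w) * hB (Z w)}].

Definition is_rcd {dX dZ : measure_display} {TX : measurableType dX}
    {TZ : measurableType dZ}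
    (Z : Omega -> TZ) (X : Omega -> TX) (kappa : TZ -> probability TX R) : Prop :=
  forall A : set TX, measurable A ->
    measurable_fun setT ((fun z => kappa z A) : TZ -> \bar R) /\
    forall C : set TZ, measurable C ->
      (\int[P]_(w in Z @^-1` C) kappa (Z w) A = P (X @^-1` A `&` Z @^-1` C))%E.

End condprob.

Section causal.
Context {R : realType} {n : nat}.
Variables (TX TY : 'I_n -> ptopologicalType) (E : rel 'I_n).

Notation PX := (DProd TX).
Notation PY := (DProd TY).

Definition G_compatible (mu : probability PX R) : Prop :=
  forall i : 'I_n, (0 < i)%N ->
    cond_indep mu (fun x : PX => (x i : Borel (TX i)))
                  (dsub (lt_set i)) (dsub (pa E i)).

Definition coupling (mu : probability PX R) (nu : probability PY R)
    (pi : probability (PX * PY)%type R) : Prop :=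
  (forall A : set PX, measurable A -> pi (A `*` setT) = mu A) /\
  (forall B : set PY, measurable B -> pi (setT `*` B) = nu B).

Definition G_causal (pi : probability (PX * PY)%type R) : Prop :=
  exists (d : measure_display) (Omega : measurableType d)
         (P : probability Omega R)
         (X : Omega -> PX) (Y : Omega -> PY) (U : 'I_n -> Omega -> R)
         (g : forall i : 'I_n,
            (Borel (TX i) * DProd (fam TX (pa E i)) * DProd (fam TY (pa E i)) * R)%type
              -> Borel (TY i)),
    [/\
        measurable_fun setT (fun w => (X w, Y w)) /\
        (forall A : set (PX * PY)%type, measurable A ->
           P ((fun w => (X w, Y w)) @^-1` A) = pi A),
        measurable_fun setT X /\ (forall i, measurable_fun setT (U i)),
        (forall (A : set PX) (B : 'I_n -> set R), measurable A ->
           (forall i, measurable (B i)) ->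
           P (X @^-1` A `&` \bigcap_i (U i @^-1` B i)) =
           (P (X @^-1` A) * \prod_(i < n) P (U i @^-1` B i))%E),
        (forall i, measurable_fun setT (g i)) &
        (forall i w, Y w i = g i (X w i, dsub (pa E i) (X w),
                                  dsub (pa E i) (Y w), U i w))].

End causal.

Arguments G_compatible {R n TX} E mu.
Arguments coupling {R n TX TY} mu nu pi.
Arguments G_causal {R n TX TY} E pi.

(* Main.v *)
Require Import Defs.
From HB Require Import structures.
From mathcomp Require Import all_boot all_order all_algebra.
From mathcomp Require Import all_classical all_reals all_analysis.
From mathcomp Require Import measurable_realfun lra.
Import Order.TTheory GRing.Theory Num.Theory.
Import numFieldNormedType.Exports.
Local Open Scope classical_set_scope.
Local Open Scope ring_scope.

(* Conditional independence of S and W given Z is rephrased as: the conditional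
   probability of {S in A} given the sigma-algebra generated by W and Z has a
   version that is a function of Z. In this form conditional independence is
   symmetric, and adjoining to the conditioning sigma-algebra a variable that is
   conditionally independent of S does not change the conditional law of S.

   (ii) <-> (iii): adjoin Y_1, ..., Y_(i-1), one at a time, to the conditioning
   of X_i, starting from the G-compatibility of mu; conversely adjoin
   X_(i+1), ..., X_n to the conditioning of Y_i.
   (iii) <-> (iv): contraction and weak union after exchanging the roles of
   (X_i, Y_i) and of the past; regular conditional distributions exist because
   the spaces are Polish.
   (i) -> (ii): U_i is independent of (X, U_1, ..., U_(i-1)), hence of
   (X, Y_1, ..., Y_(i-1)).
   (ii) -> (i): a Polish space embeds measurably in [0, 1] with a measurable left
   inverse (ternary digits of the indicators of countably many balls), so a
   conditional quantile transform produces g_i with Y_i ~ g_i(Z_i, U) given Z_i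
   and U uniform. Solving the structural equations with X ~ mu and independent
   uniform U_i gives the law pi, by induction on the number of coordinates. *)

(** * Versions of conditional probabilities *)

Section conditional_probability_versions.
Local Open Scope ereal_scope.

(** Sigma-algebras are represented by generating systems of events rather than by random variables:
    adjoining one coordinate then enlarges an index set, whereas for variables it would change a
    dependent product type. Conditional probabilities are versions with values in [0, 1] everywhere,
    so that nonnegative integration suffices, and two versions may be exchanged up to a null set.

    The obstacle in (ii) -> (i) is that a conditional distribution function is given level by level,
    each level only up to a null set. The quantile is therefore an infimum over rational levels, and
    monotonicity in the level is used only almost surely.

    The map [g] obtained in this way serves twice: as structural function in (i), and, through the
    law of [g (z, U)], as a regular conditional distribution. The second use matters in (iv), whose
    kernel identity ranges over all regular conditional distributions and would say nothing if none
    existed. *)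

Lemma measurable_preimage {d d'} {T : measurableType d} {T' : measurableType d'}
    {J : T -> T'} {C : set T'} : measurable_fun setT J -> measurable C ->
  measurable (J @^-1` C).
Proof. by move=> mJ mC; rewrite -[_ @^-1` _]setTI; exact: mJ. Qed.

Lemma integral_mrestr {d} {T : measurableType d} {R : realType}
    (mu : {measure set T -> \bar R}) (E D : set T) (mE : measurable E)
    (f : T -> \bar R) : measurable D -> measurable_fun D f ->
    (forall x, D x -> 0 <= f x) ->
  \int[mrestr mu mE]_(x in D) f x = \int[mu]_(x in E `&` D) f x.
Proof.
move=> mD mf f0.
have mDE : measurable (D `&` E) by exact: measurableI.
have mDnE : measurable (D `\` E) by exact: measurableD.
have DE : D = (D `&` E) `|` (D `\` E) by rewrite setUIDK.
rewrite {1}DE ge0_integral_setU//; last 3 first.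
- by rewrite -DE.
- by rewrite -DE.
- by rewrite disj_set2E; apply/eqP/seteqP; split=> // x [[_ ?] []].
rewrite [X in _ + X](_ : _ = 0) ?adde0; last first.
  apply: null_set_integral => //.
    by apply: measurable_funS mf => //; exact: subDsetl.
  rewrite [LHS](_ : _ = mu ((D `\` E) `&` E))// setDKI measure0//.
rewrite setIC; apply: eq_measure_integral => A mA AED.
by rewrite [LHS](_ : _ = mu (A `&` E))// setIidl// => x /AED[].
Qed.

(** On every measurable subset of the set where g < f the two integrals must coincide. Hence f = g
    almost everywhere on that set, which is therefore null. *)
Lemma ae_le_of_integral {d} {T : measurableType d} {R : realType}
    (mu : {measure set T -> \bar R}) (f g : T -> \bar R) :
  mu.-integrable setT f -> mu.-integrable setT g ->
  (forall C, measurable C ->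
    \int[mu]_(x in C) f x <= \int[mu]_(x in C) g x) ->
  {ae mu, forall x, f x <= g x}.
Proof.
move=> intf intg fg.
have mf := measurable_int _ intf; have mg := measurable_int _ intg.
pose B := [set x | g x < f x].
have mB : measurable B.
  by rewrite -[B]setTI; apply: emeasurable_fun_lt.
have : ae_eq mu B f g.
  apply: integral_ae_eq => //.
  - exact: (integrableS measurableT).
  - exact: measurable_funTS.
  move=> C CB mC; apply/eqP; rewrite eq_le fg//=; apply: le_integral => //.
  - exact: (integrableS measurableT).
  - exact: (integrableS measurableT).
  - by move=> x /set_mem/CB/ltW.
apply: filterS => x /= fgx; rewrite leNgt; apply/negP => gf.
by have := gf; rewrite (fgx gf) ltxx.
Qed.

Context {R : realType} {d : measure_display} {Omega : measurableType d}.
Variable P : probability Omega R.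

Lemma ae_distribution {d'} {T : measurableType d'} {J : Omega -> T}
    (mJ : measurable_fun setT J) (Q : T -> Prop) :
  {ae pushforward P J, forall t, Q t} -> {ae P, forall w, Q (J w)}.
Proof.
move=> [N [mN N0 QN]]; exists (J @^-1` N); split=> //.
  exact: (measurable_preimage mJ).
by move=> w /QN.
Qed.

(** The comparison is made under the law of [J]: there the test sets exhaust all measurable sets,
    whereas on [Omega] they only reach preimages under [J]. *)
Lemma cprob_version_ae_le {d'} {T : measurableType d'} {J : Omega -> T}
    (E E' : set Omega) (f f' : T -> R) : measurable_fun setT J ->
  cprob_version P J E f -> cprob_version P J E' f' ->
  (forall C, measurable C -> P (E `&` J @^-1` C) <= P (E' `&` J @^-1` C)) ->
  {ae P, forall w, (f (J w) <= f' (J w))%R}.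
Proof.
move=> mJ [mf intf fE] [mf' intf' fE'] le.
pose Jm : {mfun Omega >-> T} := HB.pack J (isMeasurableFun.Build _ _ _ _ _ mJ).
apply: (ae_distribution mJ (fun t => (f t <= f' t)%R)).
have int h : measurable_fun setT h -> P.-integrable setT (EFin \o (h \o J)) ->
    (distribution P Jm).-integrable setT (EFin \o h).
  by move=> mh inth; apply: integrable_pushforward => //; exact/measurable_EFinP.
have eqint h C : measurable C -> measurable_fun setT h ->
    P.-integrable setT (EFin \o (h \o J)) ->
    \int[distribution P Jm]_(x in C) (h x)%:E =
    \int[P]_(w in J @^-1` C) (h (J w))%:E.
  move=> mC mh inth; rewrite /distribution integral_pushforward//.
    exact/measurable_EFinP.
  apply: (integrableS measurableT) => //.
  exact: (measurable_preimage mJ).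
have := @ae_le_of_integral _ _ _ (distribution P Jm) _ _ (int _ mf intf)
  (int _ mf' intf').
move=> H; apply: H => C mC.
by rewrite !eqint// fE// fE'//; exact: le.
Qed.

Lemma cprob_version_unique {d'} {T : measurableType d'} {J : Omega -> T}
    (E : set Omega) (f f' : T -> R) : measurable_fun setT J ->
  cprob_version P J E f -> cprob_version P J E f' ->
  {ae P, forall w, f (J w) = f' (J w)}.
Proof.
move=> mJ fE f'E.
have := cprob_version_ae_le _ _ _ _ mJ fE f'E (fun _ _ => lexx _).
have := cprob_version_ae_le _ _ _ _ mJ f'E fE (fun _ _ => lexx _).
by apply: filterS2 => w /= a b; apply/eqP; rewrite eq_le a b.
Qed.

(** The bounds hold at every point, not just almost everywhere, which settles integrability and the
    sign conditions of the integral lemmas. *)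
Definition cver {d'} {T : measurableType d'} (J : Omega -> T)
    (E : set Omega) (f : T -> R) : Prop :=
  [/\ measurable_fun setT f, (forall t, 0 <= f t <= 1)%R &
      forall C, measurable C ->
        P (E `&` J @^-1` C) = \int[P]_(w in J @^-1` C) (f (J w))%:E].

Lemma cver_cprob_version {d'} {T : measurableType d'} (J : Omega -> T)
    (E : set Omega) (f : T -> R) : measurable_fun setT J ->
  cver J E f -> cprob_version P J E f.
Proof.
move=> mJ [mf f01 fE]; split=> //; last by move=> C mC; rewrite fE.
apply/integrableP; split.
  by apply/measurable_EFinP; apply: measurableT_comp.
apply: (@le_lt_trans _ _ (\int[P]_w 1)).
  apply: ge0_le_integral => //.
    by apply: measurableT_comp => //; apply/measurable_EFinP/measurableT_comp.
  by move=> w _ /=; rewrite lee_fin ger0_norm; case/andP: (f01 (J w)).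
rewrite integral_cst// mul1e; exact: (le_lt_trans (probability_le1 P measurableT) (ltry 1)).
Qed.

Lemma cver_unique {d'} {T : measurableType d'} {J : Omega -> T}
    (E : set Omega) (f f' : T -> R) : measurable_fun setT J ->
  cver J E f -> cver J E f' -> {ae P, forall w, f (J w) = f' (J w)}.
Proof.
by move=> mJ fE f'E; apply: (cprob_version_unique E f f' mJ); exact: cver_cprob_version.
Qed.

Section disintegration.
Context {d' : measure_display} {T : measurableType d'} {J : Omega -> T}.
Hypothesis mJ : measurable_fun setT J.
Variables (E : set Omega) (mE : measurable E).

Let Jm : {mfun Omega >-> T} := HB.pack J (isMeasurableFun.Build _ _ _ _ _ mJ).

(** The unnormalised law of [J] on the event [E]. Its Radon-Nikodym density with respect to the law
    of [J] is the conditional probability of [E] given [J]. *)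
Definition joint_law : set T -> \bar R := pushforward (mrestr P mE) Jm.

Let joint_law0 : joint_law set0 = 0.
Proof. exact: measure0. Qed.

Let joint_law_ge0 A : 0 <= joint_law A.
Proof. exact: measure_ge0. Qed.

Let joint_law_sigma_additive : semi_sigma_additive joint_law.
Proof. exact: measure_semi_sigma_additive. Qed.

HB.instance Definition _ := isMeasure.Build _ _ _ joint_law
  joint_law0 joint_law_ge0 joint_law_sigma_additive.

Lemma joint_lawE C : joint_law C = P (E `&` J @^-1` C).
Proof. by rewrite /joint_law /pushforward /mrestr/= setIC. Qed.

Let joint_law_finite : fin_num_fun joint_law.
Proof.
move=> C mC; rewrite joint_lawE fin_num_measure//; apply: measurableI => //.
exact: (measurable_preimage mJ).
Qed.

HB.instance Definition _ := @Measure_isFinite.Build _ _ _ joint_law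
  joint_law_finite.

Lemma joint_law_le C : measurable C -> joint_law C <= distribution P Jm C.
Proof.
move=> mC; rewrite joint_lawE; apply: le_measure; rewrite ?inE.
- by apply: measurableI => //; exact: (measurable_preimage mJ).
- exact: (measurable_preimage mJ).
- exact: subIsetr.
Qed.

Lemma joint_law_dominates : joint_law `<< distribution P Jm.
Proof.
apply/null_content_dominatesP => A mA A0.
by apply/eqP; rewrite -measure_le0 -A0; exact: joint_law_le.
Qed.

Let density := Radon_Nikodym_SigmaFinite.f joint_law (distribution P Jm).

Let density_integrable : (distribution P Jm).-integrable setT density.
Proof. exact: Radon_Nikodym_SigmaFinite.f_integrable joint_law_dominates. Qed.

Let mdensity : measurable_fun setT density.
Proof. exact: measurable_int density_integrable. Qed.

Let density_le1 : {ae distribution P Jm, forall t, density t <= 1}.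
Proof.
apply: (ae_le_of_integral _ _ (cst 1)) => //.
  exact: finite_measure_integrable_cst.
move=> C mC; rewrite /density -Radon_Nikodym_SigmaFinite.f_integral//.
  by rewrite integral_cst// mul1e; exact: joint_law_le.
exact: joint_law_dominates.
Qed.

Lemma cver_exists : exists f, cver J E f.
Proof.
(* The density is at most 1 only almost everywhere; truncation enforces the bound at every point and
   alters it on a null set only. *)
pose f t := fine (mine (density t) 1).
have d0 t : 0 <= density t.
  exact: Radon_Nikodym_SigmaFinite.f_ge0 joint_law_dominates t.
have fE t : (f t)%:E = mine (density t) 1.
  by rewrite fineK// ge0_fin_numE ?le_min ?d0//= gt_min ltry orbT.
have mf : measurable_fun setT f.
  by apply: measurableT_comp => //; exact: measurable_mine.
have f01 t : (0 <= f t <= 1)%R.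
  by rewrite -!lee_fin fE le_min d0 lee01/= ge_min lexx orbT.
exists f; split=> // C mC.
rewrite -joint_lawE (Radon_Nikodym_SigmaFinite.f_integral
  joint_law_dominates)//.
transitivity (\int[distribution P Jm]_(x in C) (f x)%:E); last first.
  rewrite /distribution ge0_integral_pushforward//.
    by apply/measurable_EFinP; exact: measurable_funTS.
  by move=> t _; rewrite lee_fin; case/andP: (f01 t).
apply: ae_eq_integral => //.
- exact: measurable_funTS.
- by apply/measurable_EFinP; exact: measurable_funTS.
- apply: filterS density_le1 => t dt _.
  by rewrite fE /Order.min; case: ltP => // dt1; apply/eqP; rewrite eq_le dt.
Qed.

Lemma cver_pull_out (f k : T -> R) (C : set T) : cver J E f ->
  measurable_fun setT k -> (forall t, 0 <= k t)%R -> measurable C ->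
  \int[P]_(w in E `&` J @^-1` C) (k (J w))%:E =
  \int[P]_(w in J @^-1` C) (k (J w) * f (J w))%:E.
Proof.
move=> [mf f01 fE] mk k0 mC.
have mJC : measurable (J @^-1` C) by apply: (measurable_preimage mJ).
have fi : (distribution P Jm).-integrable setT (EFin \o f).
  apply: (@le_integrable _ _ _ _ _ measurableT _ (cst 1)).
  - exact/measurable_EFinP.
  - by move=> t _ /=; rewrite lee_fin normr1 ger0_norm; case/andP: (f01 t).
  - exact: finite_measure_integrable_cst.
(* Any version coincides a.e. with the density of [joint_law], so the change of variables formula
   applies to it. *)
have fd : ae_eq (distribution P Jm) setT (EFin \o f) density.
  apply: integral_ae_eq => // A _ mA.
  rewrite /density -Radon_Nikodym_SigmaFinite.f_integral//; last first.
    exact: joint_law_dominates.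
  rewrite /distribution ge0_integral_pushforward//.
  - by rewrite /= joint_lawE fE.
  - by apply/measurable_EFinP; exact: measurable_funTS.
  - by move=> t _; rewrite lee_fin; case/andP: (f01 t).
transitivity (\int[joint_law]_(t in C) (k t)%:E).
  rewrite /joint_law ge0_integral_pushforward//.
  - rewrite integral_mrestr//=.
      by apply/measurable_EFinP/measurable_funTS; exact: measurableT_comp.
    by move=> w _; rewrite lee_fin.
  - by apply/measurable_EFinP; exact: measurable_funTS.
  - by move=> t _; rewrite lee_fin.
rewrite -(Radon_Nikodym_SigmaFinite.change_of_variables
  joint_law_dominates (f := fun t => (k t)%:E))//; last first.
- by apply/measurable_EFinP; exact: measurable_funTS.
transitivity (\int[distribution P Jm]_(t in C) (k t * f t)%:E).
  apply: ae_eq_integral => //.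
  - apply: emeasurable_funM; last exact: measurable_funTS.
    by apply/measurable_EFinP; exact: measurable_funTS.
  - by apply/measurable_EFinP/measurable_funTS; exact: measurable_funM.
  - by apply: filterS fd => t /= /(_ I) ft _; rewrite EFinM ft.
rewrite /distribution ge0_integral_pushforward//.
- by apply/measurable_EFinP/measurable_funTS; exact: measurable_funM.
- by move=> t _; rewrite lee_fin mulr_ge0//; case/andP: (f01 t).
Qed.

End disintegration.

End conditional_probability_versions.

(** * Conditional independence relative to a sigma-algebra *)

Section conditional_independence.
Local Open Scope ereal_scope.
Context {R : realType} {d : measure_display} {Omega : measurableType d}.
Variable P : probability Omega R.

(** Dynkin's pi-lambda theorem. The identity for [P E] covers the whole space, which need not belong
    to [G], and it yields stability under complements. *)
Lemma version_pi_lambda (G : set (set Omega)) (E : set Omega) (f : Omega -> R) :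
  measurable E -> measurable_fun setT f -> (forall w, 0 <= f w <= 1)%R ->
  G `<=` measurable -> setI_closed G -> P E = \int[P]_w (f w)%:E ->
  (forall F, G F -> P (E `&` F) = \int[P]_(w in F) (f w)%:E) ->
  forall F, <<s G >> F -> P (E `&` F) = \int[P]_(w in F) (f w)%:E.
Proof.
move=> mE mf f01 Gm GI fT fG F sF.
have f0 w : 0 <= (f w)%:E by rewrite lee_fin; case/andP: (f01 w).
have mEf D : measurable_fun D (EFin \o f).
  by apply/measurable_EFinP; exact: measurable_funTS.
suff : <<s G >> `<=` [set F | measurable F /\
    P (E `&` F) = \int[P]_(w in F) (f w)%:E] by move=> /(_ _ sF)[].
apply: lambda_system_subset => //; last by move=> A GA; split; [exact: Gm|exact: fG].
apply/dynkin_lambda_system; split.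
- by split=> //; rewrite setIT.
- move=> A [mA fA]; have mCA := measurableC mA; split=> //.
  have PE : P E = P (E `&` A) + P (E `&` ~` A).
    rewrite -measureU; [|exact: measurableI..|].
      by rewrite -setIUr setUv setIT.
    by rewrite setIACA setICr setI0.
  have fE : \int[P]_w (f w)%:E =
      \int[P]_(w in A) (f w)%:E + \int[P]_(w in ~` A) (f w)%:E.
    rewrite -ge0_integral_setU ?setUv//.
    by rewrite disj_set2E setICr.
  have : P (E `&` A) + P (E `&` ~` A) =
         P (E `&` A) + \int[P]_(w in ~` A) (f w)%:E.
    by rewrite -PE fT fE fA.
  have finA : P (E `&` A) \is a fin_num.
    by rewrite fin_num_measure//; exact: measurableI.
  by move=> /(congr1 (fun x => x - P (E `&` A))); rewrite !(addeC (P (E `&` A))) !addeK.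
- move=> A tA mA; split.
    by apply: bigcupT_measurable => k; have [] := mA k.
  rewrite ge0_integral_bigcup//; last by move=> k; have [] := mA k.
  rewrite setI_bigcupr measure_bigcup//.
  + transitivity (\sum_(k <oo) P (E `&` A k)).
      by apply: eq_eseriesl => k; rewrite in_setT.
    by apply: eq_eseriesr => k _; have [_ ->] := mA k.
  + by move=> k _; apply: measurableI => //; have [] := mA k.
  + exact: trivIset_setIl.
Qed.

(* P(S in A | sigma(G)) has, for every A, a version that is a function of Z. *)
Definition cind (G : set (set Omega)) {dS dZ} {TS : measurableType dS}
    {TZ : measurableType dZ} (S : Omega -> TS) (Z : Omega -> TZ) : Prop :=
  forall A, measurable A -> exists h : TZ -> R,
    [/\ measurable_fun setT h, (forall z, 0 <= h z <= 1)%R &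
        forall F, <<s G >> F ->
          P (S @^-1` A `&` F) = \int[P]_(w in F) (h (Z w))%:E].

(** Conditioning on the sigma-algebra generated by [G] is conditioning on this identity map, so
    results about versions given a random variable apply to sub-sigma-algebras. *)
Definition sigid (G : set (set Omega)) : Omega -> g_sigma_algebraType G := id.

Definition smeas (G : set (set Omega)) {dZ} {TZ : measurableType dZ}
  (Z : Omega -> TZ) := forall C, measurable C -> <<s G >> (Z @^-1` C).

Lemma sigma_le_measurable {G : set (set Omega)} :
  G `<=` measurable -> <<s G >> `<=` measurable.
Proof.
by move=> Gm; apply: smallest_sub => //; exact: sigma_algebra_measurable.
Qed.

Lemma sigma_le {G G' : set (set Omega)} : G `<=` <<s G' >> ->
  <<s G >> `<=` <<s G' >>.
Proof. by move=> GG'; apply: smallest_sub => //; exact: smallest_sigma_algebra. Qed.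

Lemma measurable_sigid (G : set (set Omega)) : G `<=` measurable ->
  measurable_fun setT (sigid G).
Proof. by move=> Gm _ C mC; rewrite setTI; exact: (sigma_le_measurable Gm _ mC). Qed.

Lemma smeas_fun (G : set (set Omega)) {dZ} {TZ : measurableType dZ}
    (Z : Omega -> TZ) : smeas G Z ->
  measurable_fun (setT : set (g_sigma_algebraType G)) Z.
Proof. by move=> GZ _ C mC; rewrite setTI; exact: GZ. Qed.

Lemma smeas_measurable (G : set (set Omega)) {dZ} {TZ : measurableType dZ}
    (Z : Omega -> TZ) : G `<=` measurable -> smeas G Z -> measurable_fun setT Z.
Proof.
by move=> Gm GZ _ C mC; rewrite setTI; apply: (sigma_le_measurable Gm); exact: GZ.
Qed.

Lemma smeas_pair (G : set (set Omega)) {dZ dW} {TZ : measurableType dZ}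
    {TW : measurableType dW} (Z : Omega -> TZ) (W : Omega -> TW) :
  smeas G Z -> smeas G W -> smeas G (fun w => (Z w, W w)).
Proof.
move=> /smeas_fun mZ /smeas_fun mW C mC.
have mZW := measurable_fun_pair mZ mW.
by rewrite -[_ @^-1` _]setTI; exact: (mZW).
Qed.

Lemma smeas_comp (G : set (set Omega)) {dZ dW} {TZ : measurableType dZ}
    {TW : measurableType dW} (Z : Omega -> TZ) (r : TZ -> TW) :
  measurable_fun setT r -> smeas G Z -> smeas G (r \o Z).
Proof.
move=> mr GZ C mC; rewrite comp_preimage; apply: GZ.
exact: (measurable_preimage mr).
Qed.

Lemma cver_sigid (G : set (set Omega)) (E : set Omega) (f : Omega -> R) :
  smeas G f -> (forall w, 0 <= f w <= 1)%R ->
  (forall F, <<s G >> F -> P (E `&` F) = \int[P]_(w in F) (f w)%:E) ->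
  cver P (sigid G) E f.
Proof. by move=> /smeas_fun mf f01 fE; split=> // C mC; exact: fE. Qed.

Lemma cond_indep_sym {dS dW dZ} {TS : measurableType dS}
    {TW : measurableType dW} {TZ : measurableType dZ}
    (S : Omega -> TS) (W : Omega -> TW) (Z : Omega -> TZ) :
  cond_indep P S W Z -> cond_indep P W S Z.
Proof.
move=> SW B A mB mA; have [hA [hB [hAB [vA vB vAB hE]]]] := SW A B mA mB.
exists hB, hA, hAB; split=> //; first by rewrite setIC.
by apply: filterS hE => w /=; rewrite mulrC.
Qed.

Section bridge.
Context {dS dW dZ : measure_display} {TS : measurableType dS}
  {TW : measurableType dW} {TZ : measurableType dZ}.
Variables (S : Omega -> TS) (W : Omega -> TW) (Z : Omega -> TZ).
Hypotheses (mS : measurable_fun setT S).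
Variable G : set (set Omega).

(** The events W in B, Z in C form a pi-system that generates the sigma-algebra of (W, Z). On them
    the product formula, with f pulled out of the event W in B, is the claim. *)
Lemma cond_indep_cind : measurable_fun setT W -> measurable_fun setT Z ->
  (forall F, G F -> exists2 D, measurable D & F = (fun w => (W w, Z w)) @^-1` D) ->
  cond_indep P S W Z -> cind G S Z.
Proof.
move=> mW mZ GD SW A mA.
have mSA := measurable_preimage mS mA.
have [f vf] := cver_exists P mZ _ mSA.
have [mf f01 fE] := vf.
exists f; split=> //.
pose G' := [set F : set Omega | exists B C, [/\ measurable B, measurable C &
  F = W @^-1` B `&` Z @^-1` C]].
have mG' : G' `<=` measurable.
  by move=> _ [B [C [mB mC ->]]]; apply: measurableI;
    [exact: (measurable_preimage mW)|exact: (measurable_preimage mZ)].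
have GG' : G `<=` <<s G' >>.
  move=> F /GD[D mD ->]; apply: (smeas_pair G' W Z) mD.
    move=> B mB; apply: sub_sigma_algebra; exists B, setT; split=> //.
    by rewrite preimage_setT setIT.
  move=> C mC; apply: sub_sigma_algebra; exists setT, C; split=> //.
  by rewrite preimage_setT setTI.
move=> F /(sigma_le GG'); apply: version_pi_lambda => //.
- exact: measurableT_comp.
- move=> _ _ [B [C [mB mC ->]]] [B' [C' [mB' mC' ->]]].
  exists (B `&` B'), (C `&` C'); split; [exact: measurableI..|].
  by rewrite !preimage_setI setIACA.
- by have := fE setT measurableT; rewrite preimage_setT setIT.
move=> {}F [B [C [mB mC ->]]].
have mWB := measurable_preimage mW mB.
have [hA [hB [hAB [vA vB vAB hE]]]] := SW A B mA mB.
have [k vk] := cver_exists P mZ _ mWB.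
have [mk k01 kE] := vk.
(* The versions supplied by conditional independence need not lie in [0, 1]; f and k do, and agree
   with them almost surely. *)
have fA := cprob_version_unique P _ _ _ mZ vA (cver_cprob_version P _ _ _ mZ vf).
have kB := cprob_version_unique P _ _ _ mZ vB (cver_cprob_version P _ _ _ mZ vk).
rewrite (cver_pull_out P mZ _ mWB k f C vk mf)//; last first.
  by move=> t; case/andP: (f01 t).
rewrite setIA; case: vAB => mhAB _ <- //.
apply: ae_eq_integral => //.
- exact: (measurable_preimage mZ).
- by apply/measurable_EFinP/measurable_funTS; exact: measurableT_comp.
- apply/measurable_EFinP/measurable_funTS.
  by apply: measurable_funM; exact: measurableT_comp.
- have := hE; have := fA; have := kB.
  by apply: filterS3 => w /= <- <- <-.
Qed.

(** The event W in B belongs to the sigma-algebra of [G], so P(S in A, W in B, Z in C) is the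
    integral of h(Z) over W in B, Z in C. Pulling h out leaves the product h k. *)
Lemma cind_cond_indep : G `<=` measurable -> smeas G W -> smeas G Z ->
  cind G S Z -> cond_indep P S W Z.
Proof.
move=> Gm GW GZ SZ A B mA mB.
have mW := smeas_measurable _ _ Gm GW; have mZ := smeas_measurable _ _ Gm GZ.
have [h [mh h01 hE]] := SZ A mA.
have mSA := measurable_preimage mS mA.
have mWB := measurable_preimage mW mB.
have [k vk] := cver_exists P mZ _ mWB.
have vh : cver P Z (S @^-1` A) h by split=> // C mC; apply: hE; exact: GZ.
have [mk k01 kE] := vk.
have hk01 t : (0 <= h t * k t <= 1)%R.
  have /andP[h0 h1] := h01 t; have /andP[k0 k1] := k01 t.
  by rewrite mulr_ge0//= mulr_ile1.
exists h, k, (fun z => h z * k z)%R; split.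
- exact: cver_cprob_version.
- exact: cver_cprob_version.
- apply: cver_cprob_version => //; split=> //.
    exact: measurable_funM.
  move=> C mC; rewrite -setIA hE; last first.
    exact: (@measurableI _ (g_sigma_algebraType G) _ _ (GW _ mB) (GZ _ mC)).
  rewrite (cver_pull_out P mZ _ mWB k h)// => t.
  by case/andP: (h01 t).
- by apply: aeW.
Qed.

End bridge.

Section operations.
Context {dS dZ : measure_display} {TS : measurableType dS} {TZ : measurableType dZ}.
Variables (S : Omega -> TS) (Z : Omega -> TZ).

Lemma cindS (G G' : set (set Omega)) : G' `<=` <<s G >> ->
  cind G S Z -> cind G' S Z.
Proof.
move=> GG' SZ A /SZ[h [mh h01 hE]]; exists h; split=> // F /(sigma_le GG').
exact: hE.
Qed.

Lemma cind_cond_comp (G : set (set Omega)) {d'} {T' : measurableType d'}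
    (Z' : Omega -> T') (r : T' -> TZ) : measurable_fun setT r ->
  (forall w, Z w = r (Z' w)) -> cind G S Z -> cind G S Z'.
Proof.
move=> mr rZ SZ A /SZ[h [mh h01 hE]]; exists (h \o r); split.
- exact: measurableT_comp.
- by move=> z; exact: h01.
- by move=> F /hE ->; apply: eq_integral => w _ /=; rewrite rZ.
Qed.

Lemma cind_comp (G : set (set Omega)) {d'} {T' : measurableType d'}
    (S' : Omega -> T') (r : TS -> T') : measurable_fun setT r ->
  (forall w, S' w = r (S w)) -> cind G S Z -> cind G S' Z.
Proof.
move=> mr rS SZ A mA; have [h [mh h01 hE]] := SZ _ (measurable_preimage mr mA).
exists h; split=> // F /hE <-; congr (P (_ `&` _)).
by apply/seteqP; split=> w /=; rewrite rS.
Qed.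

(* If V is independent of S given G1 then adjoining V to the conditioning
   sigma-algebra does not change the conditional law of S. *)
Lemma cind_contraction {dV dZ'} {TV : measurableType dV}
    {TZ' : measurableType dZ'} (V : Omega -> TV) (Z' : Omega -> TZ')
    (G1 G2 G' : set (set Omega)) :
  measurable_fun setT S -> measurable_fun setT V -> G1 `<=` measurable ->
  smeas G1 Z -> smeas G1 Z' -> G1 `<=` <<s G' >> -> smeas G' S ->
  (forall F, G2 F -> <<s G1 >> F \/ exists2 B, measurable B & F = V @^-1` B) ->
  cind G1 S Z -> cind G' V Z' -> cind G2 S Z.
Proof.
move=> mS mV G1m G1Z G1Z' G1G' G'S G2E SZ VZ' A mA.
have [h [mh h01 hE]] := SZ A mA; exists h; split=> //.
have mSA := measurable_preimage mS mA.
pose Gp := [set F : set Omega | exists F1 B, [/\ <<s G1 >> F1, measurable B &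
  F = F1 `&` V @^-1` B]].
have G1T : <<s G1 >> setT by exact: (@measurableT _ (g_sigma_algebraType G1)).
have mZ := smeas_measurable _ _ G1m G1Z.
have mZ' := smeas_measurable _ _ G1m G1Z'.
have G2p : G2 `<=` <<s Gp >>.
  move=> F /G2E[G1F|[B mB ->]]; apply: sub_sigma_algebra.
    by exists F, setT; split=> //; rewrite preimage_setT setIT.
  by exists setT, B; split=> //; rewrite setTI.
move=> F /(sigma_le G2p); apply: version_pi_lambda => //.
- exact: measurableT_comp.
- move=> _ [F1 [B [GF1 mB ->]]]; apply: measurableI.
    exact: sigma_le_measurable GF1.
  exact: (measurable_preimage mV).
- move=> _ _ [F1 [B [GF1 mB ->]]] [F1' [B' [GF1' mB' ->]]].
  exists (F1 `&` F1'), (B `&` B'); split.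
  + exact: (@measurableI _ (g_sigma_algebraType G1)).
  + exact: measurableI.
  + by rewrite preimage_setI setIACA.
- by have := hE _ G1T; rewrite setIT.
move=> {}F [F1 [B [GF1 mB ->]]].
have mVB := measurable_preimage mV mB.
have [k [mk k01 kE]] := VZ' B mB.
have vk : cver P (sigid G1) (V @^-1` B) (k \o Z').
  apply: cver_sigid => //; first exact: smeas_comp.
    by move=> w; exact: k01.
  by move=> F2 GF2; apply: kE; exact: (sigma_le G1G').
have vh : cver P (sigid G1) (S @^-1` A) (h \o Z).
  by apply: cver_sigid => //; [exact: smeas_comp|move=> w; exact: h01].
(* Since [S] is measurable for [G'], the law of [V] may be integrated over the event S in A
   intersected with F1. Conditioning on [G1] then turns both sides into the integral of h(Z) k(Z')
   over F1. *)
rewrite setIA setIC kE; last first.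
  apply: (@measurableI _ (g_sigma_algebraType G')); first exact: G'S.
  exact: (sigma_le G1G').
have [_ k01' _] := vk; have [_ h01' _] := vh.
have mI := measurable_sigid _ G1m.
have := cver_pull_out P mI _ mSA _ (k \o Z') F1 vh.
move=> /(_ _ _ GF1) e1; rewrite [LHS]e1; last 2 first.
- by apply: smeas_fun; exact: smeas_comp.
- by move=> t; case/andP: (k01' t).
have := cver_pull_out P mI _ mVB _ (h \o Z) F1 vk.
move=> /(_ _ _ GF1) e2; rewrite setIC [RHS]e2; last 2 first.
- by apply: smeas_fun; exact: smeas_comp.
- by move=> t; case/andP: (h01' t).
by apply: eq_integral => w _; rewrite mulrC.
Qed.

(** As [Z'] is already measurable for [G1], the version valid on [G2] is also a version given [G1].
    It thus equals the function of [Z] almost surely and can be replaced by it on [G2]. *)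
Lemma cind_refine {dZ'} {TZ' : measurableType dZ'} (Z' : Omega -> TZ')
    (G1 G2 : set (set Omega)) :
  G1 `<=` measurable -> G2 `<=` measurable ->
  smeas G1 Z -> smeas G1 Z' -> G1 `<=` <<s G2 >> ->
  cind G1 S Z -> cind G2 S Z' -> cind G2 S Z.
Proof.
move=> G1m G2m G1Z G1Z' G12 SZ SZ' A mA.
have [h [mh h01 hE]] := SZ A mA; have [k [mk k01 kE]] := SZ' A mA.
exists h; split=> // F GF; rewrite kE//.
have vk : cver P (sigid G1) (S @^-1` A) (k \o Z').
  apply: cver_sigid => //; first exact: smeas_comp.
    by move=> w; exact: k01.
  by move=> F2 GF2; apply: kE; exact: (sigma_le G12).
have vh : cver P (sigid G1) (S @^-1` A) (h \o Z).
  by apply: cver_sigid => //; [exact: smeas_comp|move=> w; exact: h01].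
have mI := measurable_sigid _ G1m.
have mZ := smeas_measurable _ _ G1m G1Z.
have mZ' := smeas_measurable _ _ G1m G1Z'.
apply: ae_eq_integral => //.
- exact: sigma_le_measurable GF.
- by apply/measurable_EFinP/measurable_funTS; exact: measurableT_comp.
- by apply/measurable_EFinP/measurable_funTS; exact: measurableT_comp.
- have := cver_unique P _ _ _ mI vk vh.
  by apply: filterS => w /= ->.
Qed.

End operations.

End conditional_independence.

Lemma measurable_fun_generated {d} {T : measurableType d} {U : pointedType}
    (G : set (set U)) (f : T -> g_sigma_algebraType G) :
  (forall A, G A -> measurable (f @^-1` A)) -> measurable_fun setT f.
Proof.
move=> mf; apply: (@measurability _ _ _ (g_sigma_algebraType G) _ _ G erefl) => _ [A GA <-].
by rewrite setTI; exact: mf.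
Qed.

(** * Coding of bit sequences in the Cantor set *)

Section ternary_expansion.
Context {R : realType}.
Implicit Types b : nat -> bool.

(** Partial sums of the series of 2 b(j) / 3^(j+1). Digits 0 and 2 in base 3 keep the code
    injective, which binary expansions are not; recursion on the head makes the shift of digits an
    affine map. *)
Fixpoint ternary_sum (n : nat) b : R :=
  if n is m.+1 then (2 * (b 0%N)%:R + ternary_sum m (b \o S)) / 3 else 0.

Lemma ternary_sum01 n b : 0 <= ternary_sum n b <= 1.
Proof.
elim: n b => [|n IHn] b /=; first by rewrite lexx ler01.
by have := IHn (b \o S); case: (b 0%N) => /=; lra.
Qed.

Lemma ternary_sum_nd b : {homo ternary_sum^~ b : n m / (n <= m)%N >-> n <= m}.
Proof.
apply/nondecreasing_seqP => n; elim: n b => [|n IHn] b.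
  by have /andP[] := ternary_sum01 1 b.
by have /= := IHn (b \o S); case: (b 0%N) => /=; lra.
Qed.

Definition ternary b : R := limn (ternary_sum^~ b).

Lemma ternary_sum_cvg b : ternary_sum^~ b @ \oo --> ternary b.
Proof.
apply: nondecreasing_is_cvgn; first exact: ternary_sum_nd.
by exists 1 => _ [n _ <-]; case/andP: (ternary_sum01 n b).
Qed.

Lemma ternary01 b : 0 <= ternary b <= 1.
Proof.
have cb := ternary_sum_cvg b; apply/andP; split.
  by apply: limr_ge; [exact: cb|near=> n; case/andP: (ternary_sum01 n b)].
by apply: limr_le; [exact: cb|near=> n; case/andP: (ternary_sum01 n b)].
Unshelve. all: by end_near. Qed.

Lemma ternaryS b : ternary b = (2 * (b 0%N)%:R + ternary (b \o S)) / 3.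
Proof.
apply: cvg_lim => //; rewrite -cvg_shiftS /=.
apply: cvgM; last exact: cvg_cst.
by apply: cvgD; [exact: cvg_cst|exact: ternary_sum_cvg].
Qed.

Definition ternary_shift (x : R) : R := if 2^-1 <= x then 3 * x - 2 else 3 * x.

Definition ternary_digit (j : nat) (x : R) : bool := 2^-1 <= iter j ternary_shift x.

(** The tail contributes at most 1/3, so the value lies in [0, 1/3] or in [2/3, 1] according to the
    first digit, and 1/2 is a threshold inside the gap. *)
Lemma ternary_digit0 b : (2^-1 <= ternary b) = b 0%N.
Proof.
rewrite ternaryS; have := ternary01 (b \o S).
case: (b 0%N) => /= h; first by apply/idP; lra.
by apply/negP; lra.
Qed.

Lemma ternary_shiftE b : ternary_shift (ternary b) = ternary (b \o S).
Proof.
rewrite /ternary_shift ternary_digit0 ternaryS.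
by case: (b 0%N) => /=; lra.
Qed.

Lemma ternary_digitK j b : ternary_digit j (ternary b) = b j.
Proof.
rewrite /ternary_digit; elim: j b => [|j IHj] b; first exact: ternary_digit0.
by rewrite iterSr ternary_shiftE IHj.
Qed.

Lemma measurable_ternary_digit j :
  measurable [set x | ternary_digit j x].
Proof.
have mi k : measurable_fun setT (iter k ternary_shift).
  elim: k => [|k IHk] /=; first exact: measurable_id.
  apply: (measurableT_comp _ IHk); apply: measurable_fun_ifT.
  - exact: measurable_fun_ler.
  - by apply: measurable_funB => //; exact: measurable_funM.
  - exact: measurable_funM.
rewrite [X in measurable X](_ : _ = iter j ternary_shift @^-1` `[2^-1, +oo[).
  exact: (measurable_preimage (mi j)).
by apply/seteqP; split=> x /=; rewrite in_itv/= andbT.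
Qed.

Lemma measurable_ternary {d} {T : measurableType d} (b : T -> nat -> bool) :
  (forall j, measurable_fun setT (b^~ j)) -> measurable_fun setT (ternary \o b).
Proof.
move=> mb.
apply: (@measurable_fun_cvg _ _ _ _ (fun n x => ternary_sum n (b x))).
  move=> n; elim: n b mb => [|n IHn] b mb /=; first exact: measurable_cst.
  apply: measurable_funM => //; apply: measurable_funD.
    apply: measurable_funM => //.
    rewrite [X in measurable_fun _ X](_ : _ = fun x => if b x 0%N then 1 else 0).
      exact: measurable_fun_ifT.
    by apply/funext => x; case: (b x 0%N).
  by apply: (IHn (fun x => b x \o S)) => j; exact: mb.
by move=> x _; exact: ternary_sum_cvg.
Qed.

End ternary_expansion.

(** * Measurable coding of a Polish space by reals *)

Section polish_coding.
Context {R : realType} {T : ptopologicalType}.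
Variables (dist : T -> T -> R) (e : nat -> T).
Hypotheses (dist0 : forall x y, dist x y = 0 <-> x = y)
  (distC : forall x y, dist x y = dist y x)
  (distD : forall x y z, dist x z <= dist x y + dist y z)
  (dist_open : forall A : set T, open A <->
    (forall x, A x -> exists2 r : R, 0 < r & [set y | dist x y < r] `<=` A))
  (dist_complete : forall u : nat -> T,
    (forall r : R, 0 < r -> exists N : nat, forall m k : nat,
       (N <= m)%N -> (N <= k)%N -> dist (u m) (u k) < r) ->
    exists l : T, forall r : R, 0 < r -> exists N : nat, forall m : nat,
       (N <= m)%N -> dist (u m) l < r)
  (e_dense : forall x (r : R), 0 < r -> exists k, dist x (e k) < r).

Let dist_ball (x : T) (r : R) := [set y | dist x y < r].

Let dist_ball_open x r : open (dist_ball x r).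
Proof.
apply/dist_open => y xy; exists (r - dist x y); first by rewrite subr_gt0.
by move=> z /= yz; apply: le_lt_trans (distD x y z) _; rewrite addrC -ltrBrDr.
Qed.

Let ex_inv (r : R) : 0 < r -> exists p : nat, p.+1%:R^-1 < r.
Proof. by move=> /ltr_add_invr[p]; rewrite add0r => ?; exists p. Qed.

Let inv_gt0 (p : nat) : 0 < p.+1%:R^-1 :> R.
Proof. by rewrite invr_gt0 ltr0n. Qed.

(** All scales 1/(m+1) and all dense points [e k] are tested at once, the pair (m, k) being numbered
    by [pickle]; numbers of no pair carry the digit 0. *)
Let bits (y : T) (j : nat) : bool :=
  if unpickle j is Some mk then dist (e mk.2) y < mk.1.+1%:R^-1 else false.

Definition polish_code (y : Borel T) : R := ternary (bits y).

Lemma measurable_polish_code : measurable_fun setT polish_code.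
Proof.
apply: (@measurable_ternary _ _ (Borel T) (bits : Borel T -> _)) => j.
rewrite /bits; case: unpickle => [[m k]|]; last exact: measurable_cst.
apply: (@measurable_fun_bool _ _ _ _ true).
rewrite setTI [X in measurable X](_ : _ = dist_ball (e k) m.+1%:R^-1).
  by apply: sub_sigma_algebra; exact: dist_ball_open.
by apply/seteqP; split=> y /=.
Qed.

Let near_set (m k : nat) := [set x : R | ternary_digit (pickle (m, k)) x].

(** Taking the least admissible index makes the choice of a dense point near the encoded point
    measurable. The default 0 is for reals with no digit set at scale m. *)
Let centre (m : nat) (x : R) : nat :=
  xget 0%N [set k | near_set m k x /\ forall k', (k' < k)%N -> ~ near_set m k' x].

Let centre_preim m k : measurable (centre m @^-1` [set k]).
Proof.
pose F k := near_set m k `&` \bigcap_(k' in `I_k) ~` near_set m k'.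
have mn k' : measurable (near_set m k') by exact: measurable_ternary_digit.
have mF k' : measurable (F k').
  apply: measurableI => //; apply: bigcap_measurableType => k'' _.
  exact: measurableC.
have FE x k1 k2 : F k1 x -> F k2 x -> k1 = k2.
  move=> [n1 h1] [n2 h2]; have [lt|lt|//] := ltngtP k1 k2.
    by have := h2 _ lt.
  by have := h1 _ lt.
(* The index 0 doubles as default value, so its preimage also contains the reals for which no index
   is admissible. *)
have [k0|k0] := eqVneq k 0%N; last first.
  rewrite [X in measurable X](_ : _ = F k)//.
  apply/seteqP; split=> x /=; rewrite /centre.
    case: xgetP => [k1 -> [h1 h2] <-|_ h]; first by split.
    by rewrite h eqxx in k0.
  move=> Fx; case: xgetP => [k1 -> [h1 h2]|/(_ k)[]]; first exact: FE Fx.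
  by case: Fx.
rewrite [X in measurable X](_ : _ = F k `|` \bigcap_k' ~` F k').
  apply: measurableU => //; apply: bigcap_measurableType => k' _.
  exact: measurableC.
rewrite k0; apply/seteqP; split=> x /=; rewrite /centre.
  case: xgetP => [k1 -> [h1 h2] <-|h _]; first by left; split.
  by right=> k' _ [h1 h2]; apply: (h k').
move=> [Fx|nF]; case: xgetP => [k1 -> [h1 h2]|//]; first exact: FE Fx.
by exfalso; apply: (nF _ Logic.I); split; [exact: h1|exact: h2].
Qed.

Let measurable_centre m (Q : nat -> Prop) : measurable [set x | Q (centre m x)].
Proof.
rewrite [X in measurable X](_ : _ = \bigcup_(k in Q) centre m @^-1` [set k]).
  by apply: bigcup_measurable => k _; exact: centre_preim.
apply/seteqP; split=> [x Qx|x [k Qk /= xk]]; first by exists (centre m x).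
by rewrite /= xk.
Qed.

Let approx (x : R) (m : nat) : T := e (centre m x).

Let dist_cvg (u : nat -> T) (l : T) := forall r : R, 0 < r ->
  exists N : nat, forall m, (N <= m)%N -> dist (u m) l < r.

Let dist_cvg_unique u l y : dist_cvg u l -> dist_cvg u y -> l = y.
Proof.
move=> cl cy; apply/dist0; apply/eqP; rewrite eq_le; apply/andP; split; last first.
  have := distD l y l; have := (dist0 l l).2 erefl; have := distC y l; lra.
rewrite leNgt; apply/negP => ly.
have r0 : 0 < dist l y / 2 by rewrite divr_gt0.
have [N1 h1] := cy _ r0; have [N2 h2] := cl _ r0.
have := h1 _ (leq_maxl N1 N2); have := h2 _ (leq_maxr N1 N2).
have := distC l (u (maxn N1 N2)); have := distD l (u (maxn N1 N2)) y; lra.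
Qed.

(** The decoder is total, with the value [point] where the chosen dense points diverge: it will be
    applied to quantiles, which may leave the range of the code. *)
Definition polish_decode (x : R) : Borel T := xget point (dist_cvg (approx x)).

Lemma polish_codeK y : polish_decode (polish_code y) = y.
Proof.
pose x := polish_code y; have nE m k : near_set m k x <-> dist (e k) y < m.+1%:R^-1.
  by rewrite /near_set /= /x /polish_code ternary_digitK /bits pickleK.
have cx : dist_cvg (approx x) y.
  have c1 m : dist (approx x m) y < m.+1%:R^-1.
    apply/nE; rewrite /approx /centre; case: xgetP => [k -> [] //|h].
    exfalso; have [k ek] := e_dense y _ (inv_gt0 m).
    have ex : exists k, `[< near_set m k x >].
      by exists k; apply/asboolP/nE; rewrite distC.
    case: (ex_minnP ex) => k0 /asboolP hk0 min; apply: (h k0); split=> // k' lt hk'.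
    by have := min k' (asboolT hk'); rewrite leqNgt lt.
  move=> r /ex_inv[p pr]; exists p => m pm; apply: lt_trans (c1 m) _.
  by apply: le_lt_trans pr; rewrite lef_pV2 ?posrE ?ltr0n// ler_nat.
rewrite /polish_decode; case: xgetP => [l -> cl|/(_ y)//].
exact: dist_cvg_unique cl cx.
Qed.

Let Cv : set R := [set x | exists l, dist_cvg (approx x) l].

(** Convergence in countable form: late terms are compared with a dense point instead of the unknown
    limit. This is the Cauchy property, and completeness gives the converse. *)
Let CvE : Cv = \bigcap_p \bigcup_q \bigcup_N \bigcap_(m in [set m | (N <= m)%N])
  [set x | dist (approx x m) (e q) < p.+1%:R^-1].
Proof.
apply/seteqP; split=> x.
  move=> [l cl] p _; pose r : R := p.+1%:R^-1.
  have r0 : 0 < r / 2 by rewrite divr_gt0// /r.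
  have [q lq] := e_dense l _ r0; have [N h] := cl _ r0.
  exists q => //; exists N => // m /= Nm.
  have := h m Nm; have := distD (approx x m) l (e q); rewrite -/r; lra.
move=> h; apply: dist_complete => r r0.
have [p pr] := ex_inv _ (divr_gt0 r0 (ltr0Sn _ 1)).
have [q _ [N _ hN]] := h p Logic.I; exists N => m k Nm Nk.
have hm : dist (approx x m) (e q) < p.+1%:R^-1 := hN m Nm.
have hk : dist (approx x k) (e q) < p.+1%:R^-1 := hN k Nk.
have := distD (approx x m) (e q) (approx x k); have := distC (e q) (approx x k).
by move: pr hm hk; move: (p.+1%:R^-1) => v; lra.
Qed.

Let measurable_Cv : measurable Cv.
Proof.
rewrite CvE; apply: bigcap_measurableType => p _.
apply: bigcupT_measurable => q; apply: bigcupT_measurable => N.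
apply: bigcap_measurableType => m _.
exact: (measurable_centre m (fun k => dist (e k) (e q) < p.+1%:R^-1)).
Qed.

Let decode_cvg x : Cv x -> dist_cvg (approx x) (polish_decode x).
Proof. by move=> Cx; apply: xgetPex. Qed.

(** The slack 1/(p+1) keeps the inequality strict in the limit; conversely, a limit strictly inside
    the ball leaves such a slack for all late terms. *)
Let decode_ball q (r : R) : Cv `&` polish_decode @^-1` dist_ball (e q) r =
  Cv `&` \bigcup_p \bigcup_N \bigcap_(m in [set m | (N <= m)%N])
  [set x | dist (e q) (approx x m) < r - p.+1%:R^-1].
Proof.
apply/seteqP; split=> x [Cx h]; split=> //; have cl := decode_cvg _ Cx.
  move: h; rewrite /= /dist_ball /= => h.
  have r0 : 0 < (r - dist (e q) (polish_decode x)) / 2.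
    by rewrite divr_gt0// subr_gt0.
  have [p pr] := ex_inv _ r0; have [N hN] := cl _ r0.
  exists p => //; exists N => // m /= Nm; have := hN m Nm.
  have := distD (e q) (polish_decode x) (approx x m).
  have := distC (polish_decode x) (approx x m); move: pr.
  by move: (p.+1%:R^-1) => v; lra.
move: h => [p _ [N _ h]]; rewrite /= /dist_ball /=.
have [N' h'] := cl _ (inv_gt0 p).
have hm : dist (e q) (approx x (maxn N N')) < r - p.+1%:R^-1 :=
  h _ (leq_maxl N N').
have := h' _ (leq_maxr N N').
have := distD (e q) (approx x (maxn N N')) (polish_decode x); move: hm.
by move: (p.+1%:R^-1) => v; lra.
Qed.

Let measurable_decode_ball q (r : R) :
  measurable (polish_decode @^-1` dist_ball (e q) r).
Proof.
set B := polish_decode @^-1` _.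
have -> : B = (Cv `&` B) `|` (~` Cv `&` B) by rewrite -setIUl setUv setTI.
apply: measurableU.
  rewrite decode_ball; apply: measurableI => //.
  apply: bigcupT_measurable => p; apply: bigcupT_measurable => N.
  apply: bigcap_measurableType => m _.
  exact: (measurable_centre m (fun k => dist (e q) (e k) < r - p.+1%:R^-1)).
have dn x : ~ Cv x -> polish_decode x = point.
  by move=> nC; rewrite /polish_decode; case: xgetP => // l _ cl; case: nC; exists l.
have [pB|pB] := pselect (dist_ball (e q) r point).
  rewrite [X in measurable X](_ : _ = ~` Cv); first exact: measurableC.
  by apply/seteqP; split=> [x []//|x nC]; split=> //; rewrite /B /= dn.
rewrite [X in measurable X](_ : _ = set0); first exact: measurable0.
by apply/seteqP; split=> [x [nC]|//]; rewrite /B /= dn.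
Qed.

Lemma measurable_polish_decode : measurable_fun setT polish_decode.
Proof.
apply: measurable_fun_generated => A oA.
pose I := [set qp : nat * nat | dist_ball (e qp.1) qp.2.+1%:R^-1 `<=` A].
have -> : A = \bigcup_(qp in I) dist_ball (e qp.1) qp.2.+1%:R^-1.
  apply/seteqP; split=> [x Ax|x [qp Iqp]]; last exact: Iqp.
  have [r r0 rA] := (dist_open A).1 oA x Ax.
  (* A ball of radius 1/(p+1) < r/2 whose centre is that close to x contains x and stays within
     distance r of x. *)
  have [p pr] := ex_inv _ (divr_gt0 r0 (ltr0Sn _ 1)).
  have [q xq] := e_dense x _ (inv_gt0 p).
  exists (q, p); last by rewrite /dist_ball /= distC.
  move=> y /= yq; apply: rA => /=.
  have := distD x (e q) y; move: pr xq yq; rewrite /dist_ball /=.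
  by move: (p.+1%:R^-1) => v; lra.
rewrite preimage_bigcup bigcup_mkcond; apply: countable_bigcupT_measurable => // qp.
by case: ifP => _; [exact: measurable_decode_ball|exact: measurable0].
Qed.

End polish_coding.

Lemma polish_coding_exists (R : realType) (T : ptopologicalType) : polish R T ->
  exists (phi : Borel T -> R) (psi : R -> Borel T),
    [/\ measurable_fun setT phi, measurable_fun setT psi,
        cancel phi psi & forall y, 0 <= phi y <= 1].
Proof.
move=> [[D [cD dD]] [dist [d0 dC dD' dO dc]]].
have [f finj] := countable_injP _ cD.
(* An enumeration of [D] by inverting the injection [f]; indices outside its range get the value
   [point], which does not affect density. *)
pose e k := xget point [set x | D x /\ f x = k].
have ef x : D x -> e (f x) = x.
  move=> Dx; rewrite /e; case: xgetP => [y _ [Dy fxy]|/(_ x)[]//].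
  by apply: finj; rewrite ?inE.
have e_dense x (r : R) : 0 < r -> exists k, dist x (e k) < r.
  move=> r0; have : closure D x by rewrite dD.
  move=> /(_ [set y | dist x y < r])[].
    apply: open_nbhs_nbhs; split; last by rewrite /= (d0 x x).2.
    apply/dO => y /= xy; exists (r - dist x y); first by rewrite subr_gt0.
    by move=> z /= yz; apply: le_lt_trans (dD' x y z) _; rewrite addrC -ltrBrDr.
  by move=> y [Dy xy]; exists (f y); rewrite ef.
exists (polish_code dist e), (polish_decode dist e); split.
- exact: measurable_polish_code.
- exact: measurable_polish_decode.
- by move=> y; exact: polish_codeK.
- by move=> y; exact: ternary01.
Qed.

(** * Functions of a variable and an independent noise *)

Section noise.
Local Open Scope ereal_scope.
Context {R : realType}.

Lemma product_measure_section {d1 d2} {T1 : measurableType d1}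
    {T2 : measurableType d2} (m1 : probability T1 R) (m2 : probability T2 R)
    (C : set T1) (D : set (T1 * T2)) :
  (m1 \x m2) ((C `*` setT) `&` D) = \int[m1]_(x in C) m2 (xsection D x).
Proof.
rewrite [LHS]/product_measure1 [RHS]integral_mkcond; apply: eq_integral => x _ /=.
rewrite patchE; case: ifPn => [/set_mem Cx|/negP xC].
  congr (m2 _); apply/seteqP; split=> y /=; rewrite /xsection/= !inE/=.
    by case.
  by split.
rewrite (_ : xsection _ _ = set0) ?measure0//.
apply/seteqP; split=> y //=; rewrite /xsection/= inE/= => -[[Cx _] _].
by apply: xC; rewrite inE.
Qed.

Context {dZ dU dT : measure_display} {TZ : measurableType dZ}
  {TU : measurableType dU} {T : measurableType dT}.
Variables (m : probability TU R) (g : TZ * TU -> T).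
Hypothesis mg : measurable_fun setT g.

Definition noise_law (A : set T) (z : TZ) : R := fine (m (xsection (g @^-1` A) z)).

Lemma noise_lawE A z : measurable A ->
  (noise_law A z)%:E = m (xsection (g @^-1` A) z).
Proof.
move=> mA; rewrite fineK// fin_num_measure//.
by apply: measurable_xsection; exact: (measurable_preimage mg).
Qed.

Lemma measurable_noise_law A : measurable A -> measurable_fun setT (noise_law A).
Proof.
move=> mA; apply: measurableT_comp => //.
by apply: measurable_fun_xsection; exact: (measurable_preimage mg).
Qed.

Lemma noise_law01 A z : measurable A -> (0 <= noise_law A z <= 1)%R.
Proof.
move=> mA; rewrite -!lee_fin noise_lawE// measure_ge0/=.
by apply: probability_le1; apply: measurable_xsection; exact: (measurable_preimage mg).
Qed.

Lemma measurable_noise_section z : measurable_fun setT (fun u => g (z, u)).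
Proof. by apply: (measurableT_comp mg); exact: pair1_measurable. Qed.

Definition noise_kernel (z : TZ) : probability T R :=
  distribution m (HB.pack_for {mfun TU >-> T} (fun u => g (z, u))
    (isMeasurableFun.Build _ _ _ _ _ (measurable_noise_section z))).

Lemma noise_kernelE A z : measurable A -> noise_kernel z A = (noise_law A z)%:E.
Proof.
move=> mA; rewrite noise_lawE// /noise_kernel /distribution /pushforward /=.
by congr (m _); apply/seteqP; split=> u /=; rewrite /xsection/= inE.
Qed.

(** Independence makes the law of (J, U) a product measure, and integrating its sections freezes
    [J]. Although [g] sees only [zeta J], the conditioning is on all of [J]. *)
Lemma indep_noise_cver {d dJ} {Omega : measurableType d} {TJ : measurableType dJ}
    (P : probability Omega R) (J : Omega -> TJ) (U : Omega -> TU)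
    (zeta : TJ -> TZ) (A : set T) :
  measurable_fun setT J -> measurable_fun setT U -> measurable_fun setT zeta ->
  (forall B C, measurable B -> measurable C ->
    P (J @^-1` B `&` U @^-1` C) = P (J @^-1` B) * m C) ->
  measurable A ->
  cver P J ((fun w => g (zeta (J w), U w)) @^-1` A) (noise_law A \o zeta).
Proof.
move=> mJ mU mz ind mA; split.
- by apply: measurableT_comp => //; exact: measurable_noise_law.
- by move=> t; exact: noise_law01.
move=> C mC.
pose Jm : {mfun Omega >-> TJ} := HB.pack J (isMeasurableFun.Build _ _ _ _ _ mJ).
have mJU := measurable_fun_pair mJ mU.
pose JU : {mfun Omega >-> (TJ * TU)%type} :=
  HB.pack (fun w => (J w, U w)) (isMeasurableFun.Build _ _ _ _ _ mJU).
pose D : set (TJ * TU) := (fun ju => g (zeta ju.1, ju.2)) @^-1` A.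
have mD : measurable D.
  apply: measurable_preimage mA; apply: (measurableT_comp mg).
  apply: measurable_fun_pair; last exact: measurable_snd.
  by apply: (measurableT_comp mz); exact: measurable_fst.
have mCD : measurable ((C `*` setT) `&` D) by apply: measurableI => //; exact: measurableX.
transitivity (distribution P JU ((C `*` setT) `&` D)).
  rewrite /distribution /pushforward/=; congr (P _); apply/seteqP.
  by split=> w /=; [case=> ? ?|case=> -[? _] ?].
rewrite -(@product_measure_unique _ _ _ _ _ (distribution P Jm) m
  (distribution P JU))//.
rewrite product_measure_section.
transitivity (\int[distribution P Jm]_(x in C) (noise_law A (zeta x))%:E).
  by apply: eq_integral => x _; rewrite noise_lawE//; congr (m _); rewrite !xsectionE.
rewrite /distribution ge0_integral_pushforward//.
- apply/measurable_EFinP/measurable_funTS/measurableT_comp => //.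
  exact: measurable_noise_law.
- by move=> t _; rewrite lee_fin; case/andP: (noise_law01 A (zeta t) mA).
Qed.

End noise.

(** The values on these rays are all that the quantile transform uses of the uniform law on
    [0, 1]. *)
Lemma uniform_exists (R : realType) : exists m : probability R R,
  forall p : R, 0 <= p <= 1 -> m [set u | u < p] = p%:E.
Proof.
have mid : measurable_fun setT (id : measurableTypeR R -> R) by [].
pose i : {mfun measurableTypeR R >-> R} :=
  HB.pack (id : measurableTypeR R -> R) (isMeasurableFun.Build _ _ _ _ _ mid).
exists (distribution (uniform_prob (@ltr01 R)) i) => p /andP[p0 p1].
rewrite /distribution /pushforward/= /uniform_prob integral_uniform_pdf.
rewrite (_ : _ `&` _ = `[0, p[%classic); last first.
  apply/seteqP; split=> u /=; rewrite !in_itv/=.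
    by case=> up /andP[-> _].
  by move=> /andP[u0 up]; split=> //; rewrite u0 (le_trans (ltW up)).
rewrite (eq_integral (cst 1%E)); last first.
  move=> u; rewrite inE/= in_itv/= => /andP[u0 up].
  by rewrite /uniform_pdf u0 (le_trans (ltW up))// subr0 invr1.
rewrite integral_cst// mul1e [LHS](lebesgue_measure_itv `[0, p[)/= lte_fin.
have [_|p0'] := ltP; first by rewrite sube0.
by congr EFin; apply/eqP; rewrite eq_le p0 p0'.
Qed.

(** Rational endpoints keep the family of test sets countable, so that null sets attached to single
    test sets can be discarded together. *)
Lemma measure_rational_rays_unique {R : realType}
    (m1 m2 : {finite_measure set R -> \bar R}) :
  (forall q : rat, m1 `]-oo, (ratr q : R)[%classic = m2 `]-oo, (ratr q : R)[%classic) ->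
  forall B, measurable B -> m1 B = m2 B.
Proof.
move=> m12.
pose G : set (set R) := [set A | exists q : rat, A = `]-oo, (ratr q : R)[%classic].
have GE : @measurable _ R = <<s G >>.
  transitivity (<<s @RGenInftyO.G R >>); first exact: RGenInftyO.measurableE.
  apply/seteqP; split; apply: smallest_sub; try exact: smallest_sigma_algebra.
    move=> _ [t ->]; rewrite [X in <<s G >> X](_ : _ =
      \bigcup_(q in [set q : rat | (ratr q : R) <= t]) `]-oo, (ratr q : R)[%classic).
      rewrite bigcup_mkcond.
      apply: (@bigcupT_measurable_rat _ (g_sigma_algebraType G)) => q.
      case: ifP => _; last exact: (@measurable0 _ (g_sigma_algebraType G)).
      by apply: sub_sigma_algebra; exists q.
    apply/seteqP; split=> x /=; rewrite in_itv/=.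
      move=> xt; have [q] := @rat_in_itvoo R x t xt; rewrite in_itv/= => /andP[xq qt].
      by exists q; [exact: ltW|rewrite /= in_itv].
    by move=> [q /= qt]; rewrite in_itv/= => xq; exact: lt_le_trans qt.
  by move=> _ [q ->]; apply: sub_sigma_algebra; exists (ratr q).
have GI : setI_closed G.
  move=> _ _ [q ->] [q' ->]; exists (Num.min q q').
  apply/seteqP; split=> x /=; rewrite !in_itv/=.
    by rewrite /Num.min; case: ifP => _ [].
  by move=> xq; split; apply: lt_le_trans xq _; rewrite ler_rat ge_min lexx ?orbT.
apply: (measure_unique G (fun n : nat => `]-oo, (ratr n%:R : R)[%classic) GE GI).
- by move=> n; exists n%:R.
- apply/seteqP; split=> // x _.
  exists (Num.bound `|x|) => //=; rewrite in_itv/= ratr_nat.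
  by apply: le_lt_trans (ler_norm x) _; exact: archi_boundP.
- by move=> _ [q ->]; exact: m12.
- by move=> k; rewrite ltey_eq fin_num_measure.
Qed.

(** * The conditional quantile transform *)

Section outsourcing.
Context {R : realType} {d dZ : measure_display} {Omega : measurableType d}
  {TZ : measurableType dZ}.
Variables (P : probability Omega R) (m : probability R R).
Hypothesis unif : forall p : R, 0 <= p <= 1 -> m [set u | u < p] = p%:E.
Variables (Z : Omega -> TZ) (mZ : measurable_fun setT Z).
Variables (s : Omega -> R) (ms : measurable_fun setT s).
Hypothesis s01 : forall w, 0 <= s w <= 1.

Let mslt (t : R) : measurable [set w | s w < t].
Proof.
rewrite [X in measurable X](_ : _ = s @^-1` `]-oo, t[).
  exact: (measurable_preimage ms).
by apply/seteqP; split=> w /=; rewrite in_itv.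
Qed.

Let cdf (t : R) : TZ -> R := sval (cid (cver_exists P mZ _ (mslt t))).

Let cdfP t : cver P Z [set w | s w < t] (cdf t).
Proof. by rewrite /cdf; case: cid. Qed.

(** The infimum over q is the quantile at level u. The value 2, above the range of [s], marks
    rejected levels and keeps the family nonempty; the maximum with 0 bounds it below even where the
    version [cdf] is positive at negative levels. *)
Let qf (q : rat) (zu : TZ * R) : R :=
  if zu.2 < cdf (ratr q) zu.1 then Num.max (ratr q) 0 else 2.

Definition quantile (zu : TZ * R) : R := inf (range (qf^~ zu)).

Let qf_ge0 q zu : 0 <= qf q zu.
Proof. by rewrite /qf; case: ifP => // _; rewrite le_max lexx orbT. Qed.

Let quantile_lt zu t : quantile zu < t <-> exists q, qf q zu < t.
Proof.
have hi : has_inf (range (qf^~ zu)).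
  by split; [exists (qf 0 zu), 0|exists 0 => _ [q _ <-]].
split=> [/(inf_lt hi.1)[_ [q _ <-]] qt|[q qt]]; first by exists q.
by apply: le_lt_trans qt; apply: ge_inf; [case: hi|exists q].
Qed.

Let measurable_qf q : measurable_fun setT (qf q).
Proof.
apply: measurable_fun_ifT => //; apply: measurable_fun_ltr.
  exact: measurable_snd.
have [mc _ _] := cdfP (ratr q).
by apply: (measurableT_comp mc); exact: measurable_fst.
Qed.

Lemma measurable_quantile : measurable_fun setT quantile.
Proof.
apply: (@measurability _ _ _ _ _ _ (@RGenInftyO.G R)).
  exact: RGenInftyO.measurableE.
move=> _ [_ [t ->] <-]; rewrite setTI.
rewrite [X in measurable X](_ : _ = \bigcup_q [set zu | qf q zu < t]).
  apply: bigcupT_measurable_rat => q.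
  rewrite [X in measurable X](_ : _ = qf q @^-1` `]-oo, t[).
    exact: (measurable_preimage (measurable_qf q)).
  by apply/seteqP; split=> w /=; rewrite in_itv.
apply/seteqP; split=> zu /=; rewrite in_itv/=.
  by move=> /quantile_lt[q qt]; exists q.
by move=> [q _ qt]; apply/quantile_lt; exists q.
Qed.

Let quantile_section t z : measurable (xsection (quantile @^-1` `]-oo, t[) z).
Proof. by apply: measurable_xsection; exact: (measurable_preimage measurable_quantile). Qed.

Let lt_section t z u : xsection (quantile @^-1` `]-oo, t[) z u <-> quantile (z, u) < t.
Proof. by rewrite /xsection /= inE /= in_itv. Qed.

Let cdf01 t z : 0 <= cdf t z <= 1.
Proof. by have [] := cdfP t. Qed.

Let mlt (p : R) : measurable [set u : R | u < p].
Proof.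
by rewrite [X in measurable X](_ : _ = `]-oo, p[%classic)//; apply/seteqP; split=> w /=; rewrite in_itv.
Qed.

Let quantile_law_lt t (C : set TZ) : measurable C ->
  P ([set w | s w < t] `&` Z @^-1` C) =
  (\int[P]_(w in Z @^-1` C) (noise_law m quantile `]-oo, t[ (Z w))%:E)%E.
Proof.
move=> mC.
have mZC := measurable_preimage mZ mC.
have mit : measurable `]-oo, t[%classic by [].
have mq := measurable_quantile.
have mnl : measurable_fun (Z @^-1` C)
    (EFin \o (noise_law m quantile `]-oo, t[ \o Z)).
  by apply/measurable_EFinP/measurable_funTS/measurableT_comp => //; exact: measurable_noise_law.
have nl0 w : (0 <= (noise_law m quantile `]-oo, t[ (Z w))%:E)%E.
  by rewrite lee_fin; case/andP: (noise_law01 m _ mq _ (Z w) mit).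
(* For t > 2 even the marker 2 is below t, so both sides are the full probability of Z in C. For t
   <= 2 a rejected level never counts. *)
have [t2|t2] := ltP 2 t.
  rewrite (_ : _ `&` _ = Z @^-1` C); last first.
    apply/setIidPr => w _ /=; have /andP[_ s1] := s01 w.
    by rewrite (le_lt_trans s1)// (lt_trans _ t2)// ltr1n.
  rewrite (eq_integral (cst 1%E)) ?integral_cst ?mul1e// => w _.
  rewrite noise_lawE// (_ : xsection _ _ = setT) ?probability_setT//.
  apply/seteqP; split=> // u _; apply/lt_section/quantile_lt; exists 0.
  rewrite /qf; case: ifP => // _; rewrite rmorph0 /Num.max ltxx.
  by rewrite (lt_trans _ t2).
have qE z u : quantile (z, u) < t <->
    exists q, Num.max (ratr q) 0 < t /\ u < cdf (ratr q) z.
  split=> [/quantile_lt[q]|[q [qt uq]]].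
    rewrite /qf /=; case: ifP => [uq qt|_]; first by exists q.
    by rewrite ltNge t2.
  by apply/quantile_lt; exists q; rewrite /qf /= uq.
apply/eqP; rewrite eq_le; apply/andP; split; last first.
  have [mct _ ct] := cdfP t; rewrite ct//.
  apply: ae_ge0_le_integral => //.
  - by move=> w _; rewrite lee_fin; case/andP: (cdf01 t (Z w)).
  - by apply/measurable_EFinP/measurable_funTS/measurableT_comp.
  (* Monotonicity of [cdf] in the level holds only almost surely for each pair of levels; with q
     rational, countably many null sets are removed. *)
  have aeq (q : rat) : {ae P, forall w, ratr q < t ->
      cdf (ratr q) (Z w) <= cdf t (Z w)}.
    have [qt|qt] := pselect (ratr q < t); last by apply: aeW => w /= /qt.
    have := cprob_version_ae_le P _ _ _ _ mZ
      (cver_cprob_version P _ _ _ mZ (cdfP (ratr q)))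
      (cver_cprob_version P _ _ _ mZ (cdfP t)).
    move=> H; have {}H := H _; apply: filterS (H _) => // D mD.
    apply: le_measure; rewrite ?inE.
    - by apply: measurableI; [exact: mslt|exact: (measurable_preimage mZ)].
    - by apply: measurableI; [exact: mslt|exact: (measurable_preimage mZ)].
    - by apply: setSI => w /= sq; exact: lt_trans qt.
  have : {ae P, forall w, forall q : rat, ratr q < t ->
      cdf (ratr q) (Z w) <= cdf t (Z w)}.
    have /ae_foralln : forall n : nat, {ae P, forall w,
        forall q : rat, unpickle n = Some q -> ratr q < t ->
        cdf (ratr q) (Z w) <= cdf t (Z w)}.
      move=> n; case E : (unpickle n : option rat) => [q|].
        by apply: filterS (aeq q) => w h q' [<-].
      by apply: aeW.
    by apply: filterS => w h q; apply: (h (pickle q)); rewrite pickleK.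
  apply: filterS => w h _; rewrite noise_lawE//.
  rewrite -(unif _ (cdf01 t (Z w))); apply: le_measure; rewrite ?inE//.
  move=> u /lt_section/qE[q [qt uq]] /=; apply: lt_le_trans uq _; apply: h.
  by apply: le_lt_trans qt; rewrite le_max lexx.
have [t0|t0] := leP t 0.
  rewrite (_ : _ `&` _ = set0) ?measure0; first exact: integral_ge0.
  apply/seteqP; split=> // w [/= st _]; have /andP[s0 _] := s01 w.
  by have := lt_le_trans st t0; rewrite ltNge s0.
(* The event s < t is approached from below so that a rational level q fits between t - 1/(k+1) and
   t; q must be positive as well, since it enters through its maximum with 0. *)
pose Fk k := [set w | s w < t - k.+1%:R^-1] `&` Z @^-1` C.
have FkE : [set w | s w < t] `&` Z @^-1` C = \bigcup_k Fk k.
  rewrite -setI_bigcupl; congr (_ `&` _); apply/seteqP; split=> w /=.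
    by move=> /ltr_add_invr[k kt]; exists k => //=; rewrite ltrBrDr.
  by move=> [k _ /=] /lt_trans; apply; rewrite gtrBl invr_gt0.
have mFk k : measurable (Fk k) by apply: measurableI => //; exact: mslt.
have ndF : nondecreasing_seq Fk.
  move=> i j ij; apply/subsetPset; apply: setSI => w /= /lt_le_trans; apply.
  by rewrite lerB// lef_pV2 ?posrE ?ltr0n// ler_nat.
rewrite FkE; have cF := nondecreasing_cvg_mu (mu := P) mFk (bigcupT_measurable _ mFk) ndF.
rewrite -(cvg_lim _ cF)//; apply: lime_le; first by apply/cvg_ex; eexists; exact: cF.
apply: nearW => k /=.
have [q /andP[q1 q2]] : exists q : rat, Num.max (t - k.+1%:R^-1) 0 < ratr q < t.
  have [|q /=] := @rat_in_itvoo R (Num.max (t - k.+1%:R^-1) 0) t.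
    by rewrite gt_max t0 andbT gtrBl invr_gt0.
  by rewrite in_itv/= => qh; exists q.
move: q1; rewrite gt_max => /andP[q1 q0].
apply: (@le_trans _ _ (P ([set w | s w < ratr q] `&` Z @^-1` C))).
  apply: le_measure; rewrite ?inE//.
    by apply: measurableI => //; exact: mslt.
  by apply: setSI => w /= sq; exact: lt_trans q1.
have [mcq _ ->//] := cdfP (ratr q).
apply: ge0_le_integral => //.
- by move=> w _; rewrite lee_fin; case/andP: (cdf01 (ratr q) (Z w)).
- by apply/measurable_EFinP/measurable_funTS/measurableT_comp.
move=> w _; rewrite noise_lawE// -(unif _ (cdf01 (ratr q) (Z w))).
apply: le_measure; rewrite ?inE// => u /= uq.
by apply/lt_section/qE; exists q; rewrite gt_max q2 t0.
Qed.

(** For fixed C both sides are finite measures in B: the law of [s] on the event Z in C, and the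
    image under [quantile] of a restricted product measure. They agree on rays. *)
Lemma quantile_cver (B : set R) : measurable B ->
  cver P Z (s @^-1` B) (noise_law m quantile B).
Proof.
move=> mB; have mq := measurable_quantile; split.
- exact: measurable_noise_law.
- by move=> z; exact: noise_law01.
move=> C mC.
have mZC := measurable_preimage mZ mC.
have mCT : measurable (C `*` [set: R]) by exact: measurableX.
pose Zm : {mfun Omega >-> TZ} := HB.pack Z (isMeasurableFun.Build _ _ _ _ _ mZ).
have lawE D : measurable D ->
    joint_law (distribution P Zm \x m)%E mq _ mCT D =
    (\int[P]_(w in Z @^-1` C) (noise_law m quantile D (Z w))%:E)%E.
  move=> mD; rewrite joint_lawE [LHS]product_measure_section.
  rewrite /distribution ge0_integral_pushforward//.
  - by apply: eq_integral => w _; rewrite noise_lawE.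
  - by apply: measurable_funTS; apply: measurable_fun_xsection; exact: (measurable_preimage mq).
rewrite -lawE// setIC -(joint_lawE P ms _ mZC).
apply: measure_rational_rays_unique mB => q.
rewrite [RHS]lawE// -quantile_law_lt// [LHS](joint_lawE P ms) setIC; congr (P (_ `&` _)).
Qed.

End outsourcing.

(** The real case is applied to the code phi(S), and the quantile is decoded by psi; psi being a
    left inverse of phi, the events psi(phi(S)) in A and S in A coincide. *)
Lemma outsourcing {R : realType} {d dZ} {Omega : measurableType d}
    {TZ : measurableType dZ} (P : probability Omega R) (m : probability R R)
    (Z : Omega -> TZ) {T : ptopologicalType} (S : Omega -> Borel T) :
  (forall p : R, 0 <= p <= 1 -> m [set u | u < p] = p%:E) ->
  measurable_fun setT Z -> measurable_fun setT S -> polish R T ->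
  exists2 g : TZ * R -> Borel T, measurable_fun setT g &
    forall A, measurable A -> cver P Z (S @^-1` A) (noise_law m g A).
Proof.
move=> unif mZ mS /polish_coding_exists[phi [psi [mphi mpsi phiK phi01]]].
have ms := measurableT_comp mphi mS.
have s01 w : 0 <= (phi \o S) w <= 1 by exact: phi01.
have mq := measurable_quantile P Z mZ _ ms.
exists (psi \o quantile P Z mZ _ ms); first exact: measurableT_comp.
move=> A mA.
have := quantile_cver P m unif Z mZ _ ms s01 _ (measurable_preimage mpsi mA).
rewrite -comp_preimage -comp_preimage (_ : psi \o (phi \o S) = S)//.
by apply/funext => w /=; rewrite phiK.
Qed.

(** * Sigma-algebras generated by coordinates *)

Section cylinders.
Context {R : realType}.

Lemma measurable_dprod_coord {I : Type} (T : I -> ptopologicalType) (i : I) :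
  measurable_fun setT (fun x : DProd T => (x i : Borel (T i))).
Proof.
move=> _ B mB; rewrite setTI; apply: sub_sigma_algebra.
by exists i, B.
Qed.

Lemma smeas_dprod {d} {Omega : measurableType d} (G : set (set Omega))
    {I : Type} (T : I -> ptopologicalType) (f : Omega -> DProd T) :
  (forall i, smeas G (fun w => (f w i : Borel (T i)))) -> smeas G f.
Proof.
move=> Gf C mC.
have mf : measurable_fun (setT : set (g_sigma_algebraType G)) f.
  by apply: measurable_fun_generated => _ [i [B [mB ->]]]; exact: Gf.
by rewrite -[_ @^-1` _]setTI; exact: mf.
Qed.

Lemma sigma_preimage {T U : Type} (f : T -> U) (G : set (set T)) (H : set (set U)) :
  (forall F, G F -> exists2 D, <<s H >> D & F = f @^-1` D) ->
  forall F, <<s G >> F -> exists2 D, <<s H >> D & F = f @^-1` D.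
Proof.
move=> GH F GF.
have : preimage_set_system setT f <<s H >> F.
  move: F GF; apply: smallest_sub.
    by apply: sigma_algebra_preimage; exact: smallest_sigma_algebra.
  by move=> A /GH[D HD ->]; exists D => //; rewrite setTI.
by move=> [D HD <-]; exists D => //; rewrite setTI.
Qed.

(** Versions given [Z] are unique almost surely, so any of them, not only the one supplied by
    [cind], remains valid on the larger sigma-algebra of [G]. *)
Lemma cind_version {d dS dZ} {Omega : measurableType d} {TS : measurableType dS}
    {TZ : measurableType dZ} (P : probability Omega R) (G : set (set Omega))
    (S : Omega -> TS) (Z : Omega -> TZ) (A : set TS) (f : TZ -> R) :
  G `<=` measurable -> smeas G Z -> cind P G S Z -> measurable A ->
  cver P Z (S @^-1` A) f -> forall F, <<s G >> F ->
  P (S @^-1` A `&` F) = (\int[P]_(w in F) (f (Z w))%:E)%E.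
Proof.
move=> Gm GZ SZ mA vf F GF; have [h [mh h01 hE]] := SZ A mA.
have mZ := smeas_measurable _ _ Gm GZ; have [mf f01 fE] := vf.
have vh : cver P Z (S @^-1` A) h by split=> // C mC; apply: hE; exact: GZ.
rewrite hE//; apply: ae_eq_integral => //.
- exact: sigma_le_measurable GF.
- by apply/measurable_EFinP/measurable_funTS; exact: measurableT_comp.
- by apply/measurable_EFinP/measurable_funTS; exact: measurableT_comp.
- by have := cver_unique P _ _ _ mZ vh vf; apply: filterS => w /= ->.
Qed.

Lemma cind_map {d d' dS dZ} {Omega : measurableType d} {Omega' : measurableType d'}
    {TS : measurableType dS} {TZ : measurableType dZ} (P : probability Omega R)
    (P' : probability Omega' R) (f : Omega -> Omega')
    (G : set (set Omega)) (G' : set (set Omega'))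
    (S : Omega' -> TS) (Z : Omega' -> TZ) :
  measurable_fun setT f -> measurable_fun setT S -> measurable_fun setT Z ->
  G' `<=` measurable ->
  (forall A, measurable A -> P (f @^-1` A) = P' A) ->
  (forall F, G F -> exists2 F', <<s G' >> F' & F = f @^-1` F') ->
  cind P' G' S Z -> cind P G (S \o f) (Z \o f).
Proof.
move=> mf mS mZ G'm Pf GG' SZ A mA; have [h [mh h01 hE]] := SZ A mA.
exists h; split=> // _ /(sigma_preimage _ _ _ GG')[F GF ->].
have mF := sigma_le_measurable G'm _ GF.
have mSA := measurable_preimage mS mA.
rewrite comp_preimage -preimage_setI Pf; last exact: measurableI.
rewrite hE//.
transitivity (\int[pushforward P f]_(w in F) (h (Z w))%:E)%E; last first.
  rewrite ge0_integral_pushforward//.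
  - by apply/measurable_EFinP/measurable_funTS; exact: measurableT_comp.
  - by move=> w _; rewrite lee_fin; case/andP: (h01 (Z w)).
by apply: eq_measure_integral => B mB _; exact: esym (Pf B mB).
Qed.

(** Only the empty set and the whole space are generated, so the constant P(S in A) is a version.
    This covers the first coordinate, whose past is empty. *)
Lemma cind_trivial {d dS dZ} {Omega : measurableType d} {TS : measurableType dS}
    {TZ : measurableType dZ} (P : probability Omega R) (G : set (set Omega))
    (S : Omega -> TS) (Z : Omega -> TZ) :
  G `<=` set0 -> measurable_fun setT S -> cind P G S Z.
Proof.
move=> G0 mS A mA; have mSA := measurable_preimage mS mA.
exists (cst (fine (P (S @^-1` A)))).
have PE : ((fine (P (S @^-1` A)))%:E = P (S @^-1` A))%E.
  by rewrite fineK// fin_num_measure.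
split=> //.
  by move=> z; rewrite -!lee_fin PE measure_ge0 probability_le1.
suff : <<s G >> `<=` [set F | F = set0 \/ F = setT].
  move=> GF F /GF[|] ->; first by rewrite setI0 measure0 integral_set0.
  rewrite setIT /= (_ : (fun _ => _) = cst (fine (P (S @^-1` A)))%:E)//.
  by rewrite integral_cst// PE -[LHS]mule1; congr (_ * _)%E; exact/esym/probability_setT.
apply: smallest_sub; last by move=> F /G0.
split; first by left.
  by move=> F [|] ->; rewrite ?setD0 ?setDT; [right|left].
move=> F FE; have [[k Fk]|h] := pselect (exists k, F k = setT).
  by right; apply/seteqP; split=> // x _; exists k => //; rewrite Fk.
left; apply/seteqP; split=> // x [k _ Fkx].
by have [Fk|Fk] := FE k; [rewrite Fk in Fkx|case: h; exists k].
Qed.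

Context {n : nat} {TX TY : 'I_n -> ptopologicalType}.
Notation PX := (DProd TX).
Notation PY := (DProd TY).
Notation Om := (PX * PY)%type.

Definition Xc (i : 'I_n) (w : Om) : Borel (TX i) := w.1 i.
Definition Yc (i : 'I_n) (w : Om) : Borel (TY i) := w.2 i.
Definition XS (S : {set 'I_n}) (w : Om) := dsub S w.1.
Definition YS (S : {set 'I_n}) (w : Om) := dsub S w.2.

Lemma measurable_Xc i : measurable_fun setT (Xc i).
Proof. exact: (measurableT_comp (measurable_dprod_coord TX i) measurable_fst). Qed.

Lemma measurable_Yc i : measurable_fun setT (Yc i).
Proof. exact: (measurableT_comp (measurable_dprod_coord TY i) measurable_snd). Qed.

(** Generators of the sigma-algebra of the X-coordinates in [S] and the Y-coordinates in [T].
    Inclusions of sigma-algebras thus reduce to inclusions of finite index sets. *)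
Definition cyl (S T : {set 'I_n}) : set (set Om) :=
  [set F | (exists2 i, i \in S & exists2 B, measurable B & F = Xc i @^-1` B) \/
           (exists2 i, i \in T & exists2 B, measurable B & F = Yc i @^-1` B)].

Lemma cyl_measurable S T : cyl S T `<=` measurable.
Proof.
move=> F [[i _ [B mB ->]]|[i _ [B mB ->]]].
  exact: (measurable_preimage (measurable_Xc i)).
exact: (measurable_preimage (measurable_Yc i)).
Qed.

Lemma cylS (S S' T T' : {set 'I_n}) : S \subset S' -> T \subset T' ->
  cyl S T `<=` cyl S' T'.
Proof.
move=> /fintype.subsetP SS' /fintype.subsetP TT' F [[i iS FB]|[i iT FB]].
  by left; exists i => //; exact: SS'.
by right; exists i => //; exact: TT'.
Qed.

Lemma cyl_sigmaS (S S' T T' : {set 'I_n}) : S \subset S' -> T \subset T' ->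
  cyl S T `<=` <<s cyl S' T' >>.
Proof.
by move=> SS' TT' F /(cylS _ _ _ _ SS' TT') ?; exact: sub_sigma_algebra.
Qed.

Lemma smeas_Xc (S T : {set 'I_n}) i : i \in S -> smeas (cyl S T) (Xc i).
Proof. by move=> iS B mB; apply: sub_sigma_algebra; left; exists i => //; exists B. Qed.

Lemma smeas_Yc (S T : {set 'I_n}) i : i \in T -> smeas (cyl S T) (Yc i).
Proof. by move=> iS B mB; apply: sub_sigma_algebra; right; exists i => //; exists B. Qed.

Lemma smeas_XS (S T S' : {set 'I_n}) : S' \subset S -> smeas (cyl S T) (XS S').
Proof.
by move=> /fintype.subsetP S'S; apply: smeas_dprod => -[j jS']; apply: smeas_Xc; exact: S'S.
Qed.

Lemma smeas_YS (S T S' : {set 'I_n}) : S' \subset T -> smeas (cyl S T) (YS S').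
Proof.
by move=> /fintype.subsetP S'T; apply: smeas_dprod => -[j jS']; apply: smeas_Yc; exact: S'T.
Qed.

Lemma smeas_fst (T : {set 'I_n}) : smeas (cyl [set: 'I_n]%SET T) (fst : Om -> PX).
Proof. by apply: smeas_dprod => i; exact: (smeas_Xc [set: 'I_n]%SET T i (finset.in_setT _)). Qed.

Lemma measurable_XS S : measurable_fun setT (XS S).
Proof.
by apply: (smeas_measurable (cyl S finset.set0)); [exact: cyl_measurable|exact: smeas_XS].
Qed.

Lemma cyl_sub_preimage (S T : {set 'I_n}) {d} {TV : measurableType d} (V : Om -> TV) :
  (forall i, i \in S -> exists2 r : TV -> Borel (TX i),
     measurable_fun setT r & forall w, Xc i w = r (V w)) ->
  (forall i, i \in T -> exists2 r : TV -> Borel (TY i),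
     measurable_fun setT r & forall w, Yc i w = r (V w)) ->
  forall F, cyl S T F -> exists2 D, measurable D & F = V @^-1` D.
Proof.
move=> hX hY F [[i /hX[r mr rE] [B mB ->]]|[i /hY[r mr rE] [B mB ->]]];
  exists (r @^-1` B); try exact: (measurable_preimage mr);
  by apply/seteqP; split=> w /=; rewrite rE.
Qed.

Lemma XS_coord (S : {set 'I_n}) i : i \in S ->
  exists2 r : DProd (fam TX S) -> Borel (TX i),
    measurable_fun setT r & forall w, Xc i w = r (XS S w).
Proof.
move=> iS; exists (fun x => x (exist _ i iS)) => //.
exact: (measurable_dprod_coord (fam TX S) (exist _ i iS)).
Qed.

Lemma YS_coord (S : {set 'I_n}) i : i \in S ->
  exists2 r : DProd (fam TY S) -> Borel (TY i),
    measurable_fun setT r & forall w, Yc i w = r (YS S w).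
Proof.
move=> iS; exists (fun x => x (exist _ i iS)) => //.
exact: (measurable_dprod_coord (fam TY S) (exist _ i iS)).
Qed.

End cylinders.

Section coordinate_transport.
Context {T : Type} {d1 d2 d3 : measure_display} {T1 : measurableType d1}
  {T2 : measurableType d2} {T3 : measurableType d3}.

(** Records that a coordinate can be read off a nested tuple, whatever its bracketing. *)
Definition factors (f : T -> T3) {d} {TV : measurableType d} (V : T -> TV) :=
  exists2 r : TV -> T3, measurable_fun setT r & forall w, f w = r (V w).

Lemma factors_fst (f : T -> T3) (V : T -> T1) (W : T -> T2) : factors f V ->
  factors f (fun w => (V w, W w)).
Proof.
move=> [r mr rE]; exists (r \o fst); last by move=> w /=.
exact: (measurableT_comp mr measurable_fst).
Qed.

Lemma factors_snd (f : T -> T3) (V : T -> T1) (W : T -> T2) : factors f W ->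
  factors f (fun w => (V w, W w)).
Proof.
move=> [r mr rE]; exists (r \o snd); last by move=> w /=.
exact: (measurableT_comp mr measurable_snd).
Qed.

Lemma factors_id (f : T -> T3) : factors f f.
Proof. by exists id => //; exact: measurable_id. Qed.

End coordinate_transport.

(** * Equivalence of (ii) and (iii) *)

Section causal_chain.
Context {R : realType} {n : nat} (E : rel 'I_n).
Context {TX TY : 'I_n -> ptopologicalType}.
Hypothesis hE : sorted_dag E.
Notation Om := (DProd TX * DProd TY)%type.
Variable pi : probability Om R.

Definition Zc (i : 'I_n) (w : Om) := (Xc i w, XS (pa E i) w, YS (pa E i) w).
Definition Zp (i : 'I_n) (w : Om) := (XS (pa E i) w, YS (pa E i) w).
Definition Wc (i : 'I_n) (w : Om) := (XS (lt_set i) w, YS (lt_set i) w).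
(** The analogue of [lt_set] for a natural number bound, which may reach n and on which induction
    can run. *)
Definition below (k : nat) : {set 'I_n} := [set j : 'I_n | (j < k)%N].

Lemma pa_sub_lt i : pa E i \subset lt_set i.
Proof. by apply/fintype.subsetP => j; rewrite !inE; exact: hE. Qed.

Lemma pa_sub_below (i : 'I_n) (k : nat) : (i <= k)%N -> pa E i \subset below k.
Proof.
by move=> ik; apply/fintype.subsetP => j; rewrite !inE => /hE ji; exact: leq_trans ik.
Qed.

Lemma smeas_Zc (S T : {set 'I_n}) i : i \in S -> pa E i \subset S ->
  pa E i \subset T -> smeas (cyl S T) (Zc i).
Proof.
move=> *; apply: smeas_pair; last exact: smeas_YS.
by apply: smeas_pair; [exact: smeas_Xc|exact: smeas_XS].
Qed.

Lemma smeas_Zp (S T : {set 'I_n}) i : pa E i \subset S -> pa E i \subset T ->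
  smeas (cyl S T) (Zp i).
Proof. by move=> *; apply: smeas_pair; [exact: smeas_XS|exact: smeas_YS]. Qed.

Lemma smeas_Wc (S T : {set 'I_n}) i : lt_set i \subset S -> lt_set i \subset T ->
  smeas (cyl S T) (Wc i).
Proof. by move=> *; apply: smeas_pair; [exact: smeas_XS|exact: smeas_YS]. Qed.

Lemma measurable_Zc i : measurable_fun setT (Zc i).
Proof.
apply: (smeas_measurable (cyl [set: 'I_n]%SET [set: 'I_n]%SET)); first exact: cyl_measurable.
by apply: smeas_Zc; rewrite ?finset.in_setT ?finset.subsetT.
Qed.

Lemma measurable_Zp i : measurable_fun setT (Zp i).
Proof.
apply: (smeas_measurable (cyl [set: 'I_n]%SET [set: 'I_n]%SET)); first exact: cyl_measurable.
by apply: smeas_Zp; rewrite ?finset.subsetT.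
Qed.

Lemma measurable_Wc i : measurable_fun setT (Wc i).
Proof.
apply: (smeas_measurable (cyl [set: 'I_n]%SET [set: 'I_n]%SET)); first exact: cyl_measurable.
by apply: smeas_Wc; rewrite ?finset.subsetT.
Qed.

Lemma Wc_Xcoord i j : j \in lt_set i -> factors (Xc j) (Wc i).
Proof. by move=> ji; apply: factors_fst; exact: XS_coord. Qed.

Lemma Wc_Ycoord i j : j \in lt_set i -> factors (Yc j) (Wc i).
Proof. by move=> ji; apply: factors_snd; exact: YS_coord. Qed.

Lemma Zc_Xcoord i : factors (Xc i) (Zc i).
Proof. by do 2 apply: factors_fst; exact: factors_id. Qed.

Lemma cond2P i :
  cond_indep pi (Yc i) (fun w => (w.1, YS (lt_set i) w)) (Zc i) <->
  cind pi (cyl [set: 'I_n]%SET (lt_set i)) (Yc i) (Zc i).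
Proof.
have mY := measurable_Yc i; have mZ := measurable_Zc i.
have sW : smeas (cyl [set: 'I_n]%SET (lt_set i)) (fun w : Om => (w.1, YS (lt_set i) w)).
  by apply: smeas_pair; [exact: smeas_fst|exact: smeas_YS].
have mW := smeas_measurable _ _ (cyl_measurable _ _) sW.
split.
  apply: cond_indep_cind => //; apply: cyl_sub_preimage => j.
    move=> _; apply: factors_fst; apply: factors_fst.
    by exists (fun x => x j) => //; exact: measurable_dprod_coord.
  by move=> ji; apply: factors_fst; apply: factors_snd; exact: YS_coord.
apply: cind_cond_indep => //; first exact: cyl_measurable.
by apply: smeas_Zc; rewrite ?finset.in_setT ?finset.subsetT// pa_sub_lt.
Qed.

Lemma cond3XP i :
  cond_indep pi (Xc i) (Wc i) (XS (pa E i)) <->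
  cind pi (cyl (lt_set i) (lt_set i)) (Xc i) (XS (pa E i)).
Proof.
split.
  apply: cond_indep_cind.
  - exact: measurable_Xc.
  - exact: measurable_Wc.
  - exact: measurable_XS.
  - apply: cyl_sub_preimage => j ji; apply: factors_fst; first exact: Wc_Xcoord.
    exact: Wc_Ycoord.
apply: cind_cond_indep.
- exact: measurable_Xc.
- exact: cyl_measurable.
- exact: smeas_Wc.
- by apply: smeas_XS; exact: pa_sub_lt.
Qed.

Lemma le_setE (i : 'I_n) : le_set i = (i |: lt_set i)%SET.
Proof. by apply/finset.setP => j; rewrite !inE leq_eqVlt. Qed.

Lemma cond3YP i :
  cond_indep pi (Yc i) (fun w => (XS (le_set i) w, YS (lt_set i) w)) (Zc i) <->
  cind pi (cyl (le_set i) (lt_set i)) (Yc i) (Zc i).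
Proof.
have mY := measurable_Yc i; have mZ := measurable_Zc i.
have sW : smeas (cyl (le_set i) (lt_set i))
    (fun w : Om => (XS (le_set i) w, YS (lt_set i) w)).
  by apply: smeas_pair; [exact: smeas_XS|exact: smeas_YS].
have mW := smeas_measurable _ _ (cyl_measurable _ _) sW.
split.
  apply: cond_indep_cind => //; apply: cyl_sub_preimage => j ji.
    by apply: factors_fst; apply: factors_fst; exact: XS_coord.
  by apply: factors_fst; apply: factors_snd; exact: YS_coord.
apply: cind_cond_indep => //; first exact: cyl_measurable.
apply: smeas_Zc; rewrite ?pa_sub_lt//; first by rewrite inE.
by rewrite le_setE; apply: fintype.subset_trans (pa_sub_lt i) _; exact: finset.subsetUr.
Qed.

Lemma cond4P i :
  cond_indep pi (fun w => (Xc i w, Yc i w)) (Wc i) (Zp i) <->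
  cind pi (cyl (lt_set i) (lt_set i)) (fun w => (Xc i w, Yc i w)) (Zp i).
Proof.
have mXY : measurable_fun setT (fun w : Om => (Xc i w, Yc i w)).
  by apply: measurable_fun_pair; [exact: measurable_Xc|exact: measurable_Yc].
split.
  apply: cond_indep_cind => //.
  - exact: measurable_Wc.
  - exact: measurable_Zp.
  - apply: cyl_sub_preimage => j ji; apply: factors_fst; first exact: Wc_Xcoord.
    exact: Wc_Ycoord.
apply: cind_cond_indep => //.
- exact: cyl_measurable.
- exact: smeas_Wc.
- by apply: smeas_Zp; exact: pa_sub_lt.
Qed.

Section cond2_cond3.
Hypothesis compatible : forall i,
  cind pi (cyl (lt_set i) finset.set0) (Xc i) (XS (pa E i)).

(** When Y_j with j < i is adjoined to the conditioning of X_i, contraction needs a sigma-algebra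
    containing X_i that does not change the law of Y_j. This is where (ii) conditions on all of X,
    later coordinates included. *)
Lemma cond2_cond3X :
  (forall i, cind pi (cyl [set: 'I_n]%SET (lt_set i)) (Yc i) (Zc i)) ->
  forall i, cind pi (cyl (lt_set i) (lt_set i)) (Xc i) (XS (pa E i)).
Proof.
move=> c2 i.
suff H k : (k <= i)%N -> cind pi (cyl (lt_set i) (below k)) (Xc i) (XS (pa E i)).
  by have := H i (leqnn i).
elim: k => [_|k IHk ki].
  by apply: cindS (compatible i); exact: cyl_sigmaS.
have kn : (k < n)%N by exact: ltn_trans (ltn_ord i).
pose j : 'I_n := Ordinal kn.
apply: (cind_contraction pi (Xc i) (XS (pa E i)) (Yc j) (Zc j)
  (cyl (lt_set i) (below k)) _ (cyl [set: 'I_n]%SET (lt_set j))).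
- exact: measurable_Xc.
- exact: measurable_Yc.
- exact: cyl_measurable.
- by apply: smeas_XS; exact: pa_sub_lt.
- apply: smeas_Zc; first by rewrite inE.
    exact: (pa_sub_below j i (ltnW ki)).
  exact: (pa_sub_below j k (leqnn k)).
- by apply: cyl_sigmaS; rewrite ?finset.subsetT.
- by apply: smeas_Xc; rewrite finset.in_setT.
- move=> F [[l lS FB]|[l]].
    by left; apply: sub_sigma_algebra; left; exists l.
  rewrite inE ltnS leq_eqVlt => /orP[/eqP lk|lk] FB.
    by right; have -> : j = l by apply/val_inj.
  by left; apply: sub_sigma_algebra; right; exists l => //; rewrite inE.
- exact: IHk (ltnW ki).
- exact: c2.
Qed.

(** When X_j with j > i is adjoined to the conditioning of Y_i, the past of X_j already contains
    Y_i, as contraction requires. *)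
Lemma cond3_cond2 :
  (forall i, cind pi (cyl (lt_set i) (lt_set i)) (Xc i) (XS (pa E i))) ->
  (forall i, cind pi (cyl (le_set i) (lt_set i)) (Yc i) (Zc i)) ->
  forall i, cind pi (cyl [set: 'I_n]%SET (lt_set i)) (Yc i) (Zc i).
Proof.
move=> c3X c3Y i.
suff H k : (i < k)%N -> (k <= n)%N ->
    cind pi (cyl (below k) (lt_set i)) (Yc i) (Zc i).
  apply: cindS (H n (ltn_ord i) (leqnn n)); apply: cyl_sigmaS => //.
  by apply/fintype.subsetP => j _; rewrite inE ltn_ord.
(* The induction really starts at the bound i + 1, where [below] is [le_set i] and the claim is the
   second half of (iii). *)
elim: k => [//|k IHk]; rewrite ltnS leq_eqVlt => /orP[/eqP ik|ik] kn.
  apply: cindS (c3Y i); apply: cyl_sigmaS => //.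
  by apply/fintype.subsetP => j; rewrite !inE -ik ltnS.
pose j : 'I_n := Ordinal kn.
apply: (cind_contraction pi (Yc i) (Zc i) (Xc j) (XS (pa E j))
  (cyl (below k) (lt_set i)) _ (cyl (lt_set j) (lt_set j))).
- exact: measurable_Yc.
- exact: measurable_Xc.
- exact: cyl_measurable.
- apply: smeas_Zc; first by rewrite inE.
    by apply: pa_sub_below; exact: ltnW.
  exact: pa_sub_lt.
- by apply: smeas_XS; exact: pa_sub_below.
- apply: cyl_sigmaS; first by apply/fintype.subsetP => l; rewrite !inE.
  by apply/fintype.subsetP => l; rewrite !inE => /ltn_trans; apply.
- by apply: smeas_Yc; rewrite inE.
- move=> F [[l]|[l lS FB]]; last by left; apply: sub_sigma_algebra; right; exists l.
  rewrite inE ltnS leq_eqVlt => /orP[/eqP lk|lk] FB.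
    by right; have -> : j = l by apply/val_inj; rewrite /= lk.
  by left; apply: sub_sigma_algebra; left; exists l => //; rewrite inE.
- exact: IHk ik (ltnW kn).
- exact: c3X.
Qed.

End cond2_cond3.

End causal_chain.

(** * Regular conditional distributions *)

Section regular_conditional_distributions.
Context {R : realType}.

Lemma measurable_dsub {n : nat} {T : 'I_n -> ptopologicalType} (S : {set 'I_n}) :
  measurable_fun setT (dsub S : DProd T -> DProd (fam T S)).
Proof.
apply: measurable_fun_generated => _ [i [B [mB ->]]].
exact: (measurable_preimage (measurable_dprod_coord T (val i))).
Qed.

Lemma cver_map {d d' dZ} {Omega : measurableType d} {Omega' : measurableType d'}
    {TZ : measurableType dZ} (P : probability Omega R) (P' : probability Omega' R)
    (f : Omega -> Omega') (Z : Omega' -> TZ) (E : set Omega') (h : TZ -> R) :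
  measurable_fun setT f -> measurable_fun setT Z -> measurable E ->
  (forall A, measurable A -> P (f @^-1` A) = P' A) ->
  cver P' Z E h -> cver P (Z \o f) (f @^-1` E) h.
Proof.
move=> mf mZ mE Pf [mh h01 hE]; split=> // C mC.
have mZC := measurable_preimage mZ mC.
rewrite comp_preimage -preimage_setI Pf; last exact: measurableI.
rewrite hE//.
transitivity (\int[pushforward P f]_(w in Z @^-1` C) (h (Z w))%:E)%E; last first.
  rewrite ge0_integral_pushforward//.
  - by apply/measurable_EFinP/measurable_funTS; exact: measurableT_comp.
  - by move=> w _; rewrite lee_fin; case/andP: (h01 (Z w)).
by apply: eq_measure_integral => B mB _; exact: esym (Pf B mB).
Qed.

Lemma rcd_cver {d dS dZ} {Omega : measurableType d} {TS : measurableType dS}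
    {TZ : measurableType dZ} (P : probability Omega R) (Z : Omega -> TZ)
    (S : Omega -> TS) (kappa : TZ -> probability TS R) (A : set TS) :
  is_rcd P Z S kappa -> measurable A ->
  cver P Z (S @^-1` A) (fun z => fine (kappa z A)).
Proof.
move=> rcd mA; have [mk kE] := rcd A mA.
have kf z : ((fine (kappa z A))%:E = kappa z A)%E.
  by rewrite fineK// fin_num_measure.
split.
- exact: measurableT_comp.
- by move=> z; rewrite -!lee_fin kf measure_ge0 probability_le1.
- by move=> C mC; rewrite -kE//; apply: eq_integral => w _; rewrite kf.
Qed.

Lemma noise_kernel_rcd {d dS dZ} {Omega : measurableType d} {TS : measurableType dS}
    {TZ : measurableType dZ} (P : probability Omega R) (m : probability R R)
    (Z : Omega -> TZ) (S : Omega -> TS) (g : TZ * R -> TS)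
    (mg : measurable_fun setT g) :
  (forall A, measurable A -> cver P Z (S @^-1` A) (noise_law m g A)) ->
  is_rcd P Z S (noise_kernel m g mg).
Proof.
move=> vg A mA; have [ml _ lE] := vg A mA; split.
  rewrite (_ : (fun z => _) = EFin \o noise_law m g A); first exact/measurable_EFinP.
  by apply/funext => z; rewrite noise_kernelE.
by move=> C mC; rewrite lE//; apply: eq_integral => w _; rewrite noise_kernelE.
Qed.

(** Every A is the preimage under phi of its preimage under psi, so a law on [T] is determined by
    its image under phi, hence by countably many events. *)
Lemma probability_polish_eq {T : ptopologicalType} (phi : Borel T -> R)
    (psi : R -> Borel T) (p1 p2 : probability (Borel T) R) :
  measurable_fun setT phi -> measurable_fun setT psi -> cancel phi psi ->
  (forall q : rat, p1 (phi @^-1` `]-oo, (ratr q : R)[%classic) =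
                   p2 (phi @^-1` `]-oo, (ratr q : R)[%classic)) ->
  forall A, measurable A -> p1 A = p2 A.
Proof.
move=> mphi mpsi phiK p12 A mA.
pose phim : {mfun Borel T >-> R} := HB.pack phi (isMeasurableFun.Build _ _ _ _ _ mphi).
have AE : A = phi @^-1` (psi @^-1` A).
  by apply/seteqP; split=> y /=; rewrite phiK.
rewrite AE; have mpA := measurable_preimage mpsi mA.
exact: (measure_rational_rays_unique (distribution p1 phim) (distribution p2 phim) p12 _ mpA).
Qed.

End regular_conditional_distributions.

(** * Equivalence of (iii) and (iv) *)

Section joint_compatibility.
Context {R : realType} {n : nat} (E : rel 'I_n).
Context {TX TY : 'I_n -> ptopologicalType}.
Hypothesis polX : forall i, polish R (TX i).
Hypothesis hE : sorted_dag E.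
Notation Om := (DProd TX * DProd TY)%type.
Variables (pi : probability Om R) (mu : probability (DProd TX) R).
Hypothesis pi_mu : forall A, measurable A -> pi (fst @^-1` A) = mu A.

Lemma compatible_cind : G_compatible E mu -> forall i,
  cind pi (cyl (lt_set i) finset.set0) (Xc i) (XS (pa E i)).
Proof.
(* [G_compatible] speaks only of positive indices; at index 0 the conditioning system is empty. *)
move=> hmu i; have [i0|i0] := posnP i.
  apply: cind_trivial; last exact: measurable_Xc.
  by move=> F [[j]|[j]]; rewrite inE// i0.
pose V (x : DProd TX) := (dsub (lt_set i) x, dsub (pa E i) x).
have mV : measurable_fun setT V.
  by apply: measurable_fun_pair; exact: measurable_dsub.
pose G' : set (set (DProd TX)) := [set F | exists2 D, measurable D & F = V @^-1` D].
have mXi := measurable_dprod_coord TX i.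
have G'm : G' `<=` measurable by move=> _ [D mD ->]; exact: (measurable_preimage mV).
apply: (cind_map pi mu fst (cyl (lt_set i) finset.set0) G'
  (fun x : DProd TX => (x i : Borel (TX i))) (dsub (pa E i))) => //.
- exact: measurable_dsub.
- move=> F [[j ji [B mB ->]]|[j]]; last by rewrite inE.
  exists ((fun x : DProd TX => (x j : Borel (TX j))) @^-1` B) => //.
  apply: sub_sigma_algebra.
  exists ((fun v : DProd (fam TX (lt_set i)) * DProd (fam TX (pa E i)) =>
    (v.1 (exist _ j ji) : Borel (TX j))) @^-1` B) => //.
  apply: (measurable_preimage _ mB).
  exact: (measurableT_comp (measurable_dprod_coord (fam TX (lt_set i))
    (exist _ j ji)) measurable_fst).
- apply: cond_indep_cind (hmu i i0) => //; exact: measurable_dsub.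
Qed.

(** Given the past, the law of X_i is a function of its X-parents, computed by lambda. Since [Zp] is
    measurable for the past, lambda of the X-parents is a version given [Zp], as is kappa. *)
Lemma cond3X_kernels i :
  cind pi (cyl (lt_set i) (lt_set i)) (Xc i) (XS (pa E i)) ->
  forall (kappa : (DProd (fam TX (pa E i)) * DProd (fam TY (pa E i)))%type ->
                  probability (Borel (TX i)) R)
         (lambda : DProd (fam TX (pa E i)) -> probability (Borel (TX i)) R),
  is_rcd pi (Zp E i) (Xc i) kappa ->
  is_rcd mu (dsub (pa E i)) (fun x : DProd TX => (x i : Borel (TX i))) lambda ->
  {ae pi, forall w, forall A, measurable A ->
     kappa (Zp E i w) A = lambda (XS (pa E i) w) A}.
Proof.
move=> c3X kappa lambda rk rl.
have mZp : measurable_fun setT (Zp E i : Om -> _) by exact: measurable_Zp.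
have one A : measurable A ->
    {ae pi, forall w, kappa (Zp E i w) A = lambda (XS (pa E i) w) A}.
  move=> mA; have vk := rcd_cver pi _ _ _ _ rk mA.
  have mXi := measurable_dprod_coord TX i.
  have vl : cver pi (XS (pa E i)) (Xc i @^-1` A) (fun x => fine (lambda x A)).
    have mdsub := measurable_dsub (T := TX) (pa E i).
    exact: (cver_map pi mu fst (dsub (pa E i)) _ _ measurable_fst mdsub
      (measurable_preimage mXi mA) pi_mu (rcd_cver mu _ _ _ _ rl mA)).
  have vl' : cver pi (Zp E i) (Xc i @^-1` A) (fun z => fine (lambda z.1 A)).
    have [ml l01 _] := vl; split=> //.
      by apply: (measurableT_comp ml); exact: measurable_fst.
    move=> C mC; apply: (cind_version pi _ (Xc i) (XS (pa E i)) A
      (fun x => fine (lambda x A)) (cyl_measurable _ _) _ c3X mA vl).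
      by apply: smeas_XS; exact: pa_sub_lt.
    by apply: smeas_Zp mC; exact: pa_sub_lt.
  have := cver_unique pi _ _ _ mZp vk vl'.
  apply: filterS => w /= kl; have := congr1 EFin kl.
  by rewrite !fineK// fin_num_measure.
(* So far each event A has its own null set. Countably many events determine a law on a Polish
   space, which yields one null set for all A. *)
have [phi [psi [mphi mpsi phiK _]]] := polish_coding_exists _ _ (polX i).
have /ae_foralln : forall k : nat, {ae pi, forall w, forall q : rat,
    unpickle k = Some q ->
    kappa (Zp E i w) (phi @^-1` `]-oo, (ratr q : R)[%classic) =
    lambda (XS (pa E i) w) (phi @^-1` `]-oo, (ratr q : R)[%classic)}.
  move=> k; case: (unpickle k : option rat) => [q|]; last exact: aeW.
  have mq : measurable (phi @^-1` `]-oo, (ratr q : R)[%classic).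
    exact: (measurable_preimage mphi).
  by apply: filterS (one _ mq) => w h q' [<-].
apply: filterS => w h; apply: (probability_polish_eq phi psi) => // q.
by apply: (h (pickle q)); rewrite pickleK.
Qed.

(** The kernel identity has content only for existing kernels, so it is instantiated with those
    built by [outsourcing]. It then replaces the version depending on [Zp] by one depending on the
    X-parents alone. *)
Lemma cond4_cond3X i :
  cind pi (cyl (lt_set i) (lt_set i)) (fun w => (Xc i w, Yc i w)) (Zp E i) ->
  (forall (kappa : (DProd (fam TX (pa E i)) * DProd (fam TY (pa E i)))%type ->
                  probability (Borel (TX i)) R)
         (lambda : DProd (fam TX (pa E i)) -> probability (Borel (TX i)) R),
    is_rcd pi (Zp E i) (Xc i) kappa ->
    is_rcd mu (dsub (pa E i)) (fun x : DProd TX => (x i : Borel (TX i))) lambda ->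
    {ae pi, forall w, forall A, measurable A ->
       kappa (Zp E i w) A = lambda (XS (pa E i) w) A}) ->
  cind pi (cyl (lt_set i) (lt_set i)) (Xc i) (XS (pa E i)).
Proof.
move=> joint kernels.
have [m unif] := uniform_exists R.
have mZp : measurable_fun setT (Zp E i : Om -> _) by exact: measurable_Zp.
have mXS : measurable_fun setT (XS (pa E i) : Om -> _) by exact: measurable_XS.
have [g1 mg1 vg1] := outsourcing pi m _ (Xc i) unif mZp (measurable_Xc i) (polX i).
have [g2 mg2 vg2] := outsourcing mu m (dsub (pa E i)) _ unif
  (measurable_dsub _) (measurable_dprod_coord TX i) (polX i).
have ae12 := kernels _ _ (noise_kernel_rcd _ _ _ _ _ mg1 vg1)
  (noise_kernel_rcd _ _ _ _ _ mg2 vg2).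
have jX : cind pi (cyl (lt_set i) (lt_set i)) (Xc i) (Zp E i).
  by apply: (cind_comp pi _ _ _ (Xc i) fst _ _ joint) => //; exact: measurable_fst.
have sZp : smeas (cyl (lt_set i) (lt_set i)) (Zp E i : Om -> _).
  by apply: smeas_Zp; exact: pa_sub_lt.
move=> A mA; exists (noise_law m g2 A); split.
- exact: measurable_noise_law.
- by move=> z; exact: noise_law01.
move=> F GF.
rewrite (cind_version pi _ _ _ _ _ (cyl_measurable _ _) sZp jX mA (vg1 A mA))//.
apply: ae_eq_integral.
- exact: sigma_le_measurable (cyl_measurable _ _) _ GF.
- apply/measurable_EFinP/measurable_funTS; apply: measurableT_comp => //.
  exact: measurable_noise_law.
- apply/measurable_EFinP/measurable_funTS; apply: measurableT_comp => //.
  exact: measurable_noise_law.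
- by apply: filterS ae12 => w /(_ A mA); rewrite !noise_kernelE// => ->.
Qed.

Lemma Zc_coords i j : j \in (i |: pa E i)%SET -> factors (Xc j : Om -> _) (Zc E i).
Proof.
rewrite !inE => /orP[/eqP ->|ji]; first exact: Zc_Xcoord.
by apply: factors_fst; apply: factors_snd; apply: XS_coord; rewrite inE.
Qed.

Let sub_pa i : pa E i \subset (i |: pa E i)%SET.
Proof. exact: finset.subsetUr. Qed.

Let G2X i j : j \in (i |: pa E i)%SET ->
  factors (Xc j : Om -> _) (fun w => ((Xc i w, Yc i w), Zp E i w)).
Proof.
rewrite !inE => /orP[/eqP ->|ji].
  by do 2 apply: factors_fst; exact: factors_id.
by apply: factors_snd; apply: factors_fst; apply: XS_coord; rewrite inE.
Qed.

Let G2Y i j : j \in (i |: pa E i)%SET ->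
  factors (Yc j : Om -> _) (fun w => ((Xc i w, Yc i w), Zp E i w)).
Proof.
rewrite !inE => /orP[/eqP ->|ji].
  by apply: factors_fst; apply: factors_snd; exact: factors_id.
by apply: factors_snd; apply: factors_snd; apply: YS_coord; rewrite inE.
Qed.

(** Weak union with roles exchanged: given X_i, Y_i and the parents, the law of the past is a
    function of [Zp], hence of [Zc]. So the past and Y_i are independent given [Zc]. *)
Lemma cond4_cond3Y i :
  cond_indep pi (fun w => (Xc i w, Yc i w)) (Wc i) (Zp E i) ->
  cind pi (cyl (le_set i) (lt_set i)) (Yc i) (Zc E i).
Proof.
move=> /cond_indep_sym c4.
have mW : measurable_fun setT (Wc i : Om -> _) by exact: measurable_Wc.
have mZp : measurable_fun setT (Zp E i : Om -> _) by exact: measurable_Zp.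
have mZc : measurable_fun setT (Zc E i : Om -> _) by exact: measurable_Zc.
have mY := measurable_Yc (TX := TX) (TY := TY) i.
have mXY : measurable_fun setT (fun w : Om => (Xc i w, Yc i w)).
  by apply: measurable_fun_pair => //; exact: measurable_Xc.
pose G2 : set (set Om) := cyl (i |: pa E i)%SET (i |: pa E i)%SET.
have c1 : cind pi G2 (Wc i) (Zp E i).
  apply: cond_indep_cind c4 => //; apply: cyl_sub_preimage => j ji; first exact: G2X.
  exact: G2Y.
have c2 : cind pi G2 (Wc i) (Zc E i).
  apply: (cind_cond_comp _ _ _ _ _ (fun z => (z.1.2, z.2))) c1 => //.
  apply: measurable_fun_pair; last exact: measurable_snd.
  by apply: measurableT_comp; [exact: measurable_snd|exact: measurable_fst].
have i2 : i \in (i |: pa E i)%SET by rewrite !inE eqxx.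
have c3 : cond_indep pi (Wc i) (Yc i) (Zc E i).
  apply: cind_cond_indep c2 => //; first exact: cyl_measurable.
    exact: smeas_Yc.
  exact: smeas_Zc.
apply: cond_indep_cind (cond_indep_sym _ _ _ _ c3) => //.
apply: cyl_sub_preimage => j.
  rewrite le_setE !inE => /orP[/eqP ->|ji].
    by apply: factors_snd; exact: Zc_Xcoord.
  by apply: factors_fst; apply: Wc_Xcoord; rewrite inE.
by move=> ji; apply: factors_fst; exact: Wc_Ycoord.
Qed.

(** Contraction with roles exchanged. The law of the past is a function of [Zp] once X_i and the
    parents are known, and a function of [Zc] once Y_i is known too; [cind_refine] merges the two
    statements. *)
Lemma cond3_cond4 i :
  cind pi (cyl (lt_set i) (lt_set i)) (Xc i) (XS (pa E i)) ->
  cind pi (cyl (le_set i) (lt_set i)) (Yc i) (Zc E i) ->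
  cond_indep pi (fun w => (Xc i w, Yc i w)) (Wc i) (Zp E i).
Proof.
move=> cX cY.
have mW : measurable_fun setT (Wc i : Om -> _) by exact: measurable_Wc.
have mZp : measurable_fun setT (Zp E i : Om -> _) by exact: measurable_Zp.
have mZc : measurable_fun setT (Zc E i : Om -> _) by exact: measurable_Zc.
have mY := measurable_Yc (TX := TX) (TY := TY) i.
have mX := measurable_Xc (TX := TX) (TY := TY) i.
pose G1 : set (set Om) := cyl (i |: pa E i)%SET (pa E i).
pose G2 : set (set Om) := cyl (i |: pa E i)%SET (i |: pa E i)%SET.
have i2 : i \in (i |: pa E i)%SET by rewrite !inE eqxx.
have lt_le : lt_set i \subset le_set i by rewrite le_setE; exact: finset.subsetUr.
have a1 : cind pi G1 (Wc i) (Zp E i).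
  have c1 : cind pi (cyl (lt_set i) (lt_set i)) (Xc i) (Zp E i).
    by apply: (cind_cond_comp _ _ _ _ _ fst) cX => //; exact: measurable_fst.
  have c2 : cond_indep pi (Xc i) (Wc i) (Zp E i).
    apply: cind_cond_indep c1 => //.
    - exact: cyl_measurable.
    - exact: smeas_Wc.
    - by apply: smeas_Zp; exact: pa_sub_lt.
  apply: cond_indep_cind (cond_indep_sym _ _ _ _ c2) => //.
  apply: cyl_sub_preimage => j.
    rewrite !inE => /orP[/eqP ->|ji]; first by apply: factors_fst; exact: factors_id.
    by apply: factors_snd; apply: factors_fst; apply: XS_coord; rewrite inE.
  by move=> ji; apply: factors_snd; apply: factors_snd; exact: YS_coord.
have a2 : cind pi G2 (Wc i) (Zc E i).
  have c2 : cond_indep pi (Yc i) (Wc i) (Zc E i).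
    apply: cind_cond_indep cY => //.
    - exact: cyl_measurable.
    - exact: smeas_Wc.
    - apply: smeas_Zc; rewrite ?pa_sub_lt//; first by rewrite inE.
      exact: fintype.subset_trans (pa_sub_lt _ hE i) lt_le.
  apply: cond_indep_cind (cond_indep_sym _ _ _ _ c2) => //.
  apply: cyl_sub_preimage => j.
    by move=> ji; apply: factors_snd; exact: Zc_coords.
  rewrite !inE => /orP[/eqP ->|ji]; first by apply: factors_fst; exact: factors_id.
  by apply: factors_snd; apply: factors_snd; apply: YS_coord; rewrite inE.
have a3 : cind pi G2 (Wc i) (Zp E i).
  apply: (cind_refine pi (Wc i) (Zp E i) (Zc E i) G1 G2) a1 a2.
  - exact: cyl_measurable.
  - exact: cyl_measurable.
  - exact: smeas_Zp.
  - exact: smeas_Zc.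
  - exact: cyl_sigmaS.
apply: cond_indep_sym; apply: cind_cond_indep a3 => //.
- exact: cyl_measurable.
- by apply: smeas_pair; [exact: smeas_Xc|exact: smeas_Yc].
- exact: smeas_Zp.
Qed.

End joint_compatibility.

(** * A probability space with independent noise *)

Section iid_noise.
Local Open Scope ereal_scope.
Context {R : realType} {n : nat} {dX : measure_display} {TX : measurableType dX}.
Variables (mu : probability TX R) (m : probability R R).

(** The space grows by one real factor per step. At stage N only the variables of index below N are
    constrained; the others are placeholders, each overwritten when its factor is added. *)
Lemma iid_noise_upto N : (N <= n)%N ->
  exists (d : measure_display) (Omega : measurableType d)
         (P : probability Omega R) (X : Omega -> TX) (U : 'I_n -> Omega -> R),
    [/\ measurable_fun setT X, (forall i, measurable_fun setT (U i)) &
        forall (A : set TX) (B : 'I_n -> set R), measurable A ->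
          (forall i, measurable (B i)) ->
          P (X @^-1` A `&` \bigcap_(i in [set i : 'I_n | (i < N)%N]) (U i @^-1` B i)) =
          mu A * \prod_(i < n | (i < N)%N) m (B i)].
Proof.
elim: N => [_|N IHN Nn].
  exists dX, TX, mu, id, (fun _ => cst 0%R); split.
  - exact: measurable_id.
  - by move=> i; exact: measurable_cst.
  move=> A B mA mB; rewrite big_pred0// mule1; congr (mu _).
  by apply/seteqP; split=> w //= [].
have [d0 [Om0 [P [X [U [mX mU PU]]]]]] := IHN (ltnW Nn).
pose j : 'I_n := Ordinal Nn.
exists _, (Om0 * R)%type, (P \x m), (X \o fst),
  (fun i w => if i == j then w.2 else U i w.1); split.
- by apply: measurableT_comp => //; exact: measurable_fst.
- move=> i; case: eqP => _; first exact: measurable_snd.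
  by apply: (measurableT_comp (mU i)); exact: measurable_fst.
move=> A B mA mB.
pose F := X @^-1` A `&` \bigcap_(i in [set i : 'I_n | (i < N)%N]) (U i @^-1` B i).
have ltN (i : 'I_n) : (i < N)%N -> i != j.
  by move=> iN; apply/eqP => ij; move: iN; rewrite ij /= ltnn.
set D := _ `&` _; have -> : D = F `*` B j.
  apply/seteqP; split=> [[w u] [/= Aw h]|[w u] [[/= Aw h] Bu]].
    split; last by have := h j; rewrite /= eqxx; apply.
    split=> // i /= iN; have := h i; rewrite /= (negbTE (ltN i iN)); apply.
    exact: ltnW.
  split=> // i /=; rewrite ltnS leq_eqVlt => /orP[/eqP iN|iN].
    have -> : i = j by exact: val_inj.
    by rewrite eqxx.
  by rewrite (negbTE (ltN i iN)); exact: h.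
have mF : measurable F.
  apply: measurableI; first exact: (measurable_preimage mX).
  apply: fin_bigcap_measurable; first exact: finite_finset.
  by move=> i _; exact: (measurable_preimage (mU i)).
rewrite [LHS]product_measure1E//.
transitivity (mu A * \prod_(i < n | (i < N)%N) m (B i) * m (B j)).
  by congr (_ * _); exact: PU.
rewrite -muleA; congr (_ * _).
rewrite [RHS](bigD1 j)/= ?ltnSn// muleC; congr (_ * _).
by apply: eq_bigl => i; rewrite -(inj_eq val_inj)/= ltnS ltn_neqAle andbC.
Qed.

Lemma iid_noise_exists :
  exists (d : measure_display) (Omega : measurableType d)
         (P : probability Omega R) (X : Omega -> TX) (U : 'I_n -> Omega -> R),
    [/\ measurable_fun setT X, (forall i, measurable_fun setT (U i)),
        forall A, measurable A -> P (X @^-1` A) = mu A,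
        forall i B, measurable B -> P (U i @^-1` B) = m B &
        forall (A : set TX) (B : 'I_n -> set R), measurable A ->
          (forall i, measurable (B i)) ->
          P (X @^-1` A `&` \bigcap_i (U i @^-1` B i)) =
          P (X @^-1` A) * \prod_(i < n) P (U i @^-1` B i)].
Proof.
have [d0 [Om0 [P [X [U [mX mU PU]]]]]] := iid_noise_upto n (leqnn n).
have {}PU (A : set TX) (B : 'I_n -> set R) : measurable A ->
    (forall i, measurable (B i)) ->
    P (X @^-1` A `&` \bigcap_i (U i @^-1` B i)) = mu A * \prod_(i < n) m (B i).
  move=> mA mB; rewrite (eq_bigl (fun i : 'I_n => (i < n)%N)); last first.
    by move=> i; rewrite ltn_ord.
  rewrite -PU//; congr (P (_ `&` _)).
  by apply/seteqP; split=> w h i _; apply: h => //=; exact: ltn_ord.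
have PX A : measurable A -> P (X @^-1` A) = mu A.
  move=> mA; have := PU A (fun=> setT) mA (fun=> measurableT).
  rewrite big1 ?mule1; last by move=> i _; exact: probability_setT.
  by move=> <-; congr (P _); apply/seteqP; split=> w //= [].
have PUi i B : measurable B -> P (U i @^-1` B) = m B.
  move=> mB; have := PU setT (fun j => if j == i then B else setT) measurableT.
  rewrite (bigD1 i)//= eqxx big1 ?mule1; last first.
    by move=> j /negbTE ->; exact: probability_setT.
  rewrite [mu _]probability_setT mul1e => <-; last by move=> j; case: ifP.
  congr (P _); apply/seteqP; split=> w /=.
    by move=> Bw; split=> // j _ /=; case: eqP => [->|].
  by move=> [_ /(_ i Logic.I)]; rewrite /= eqxx.
exists d0, Om0, P, X, U; split=> // A B mA mB.
by rewrite PU// PX//; congr (_ * _); apply: eq_bigr => i _; rewrite PUi.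
Qed.

End iid_noise.

Lemma probability_pi_system_unique {d} {T : measurableType d} {R : realType}
    (p1 p2 : probability T R) (G : set (set T)) :
  G `<=` measurable -> setI_closed G -> G setT ->
  (forall A, G A -> p1 A = p2 A) -> forall A, <<s G >> A -> p1 A = p2 A.
Proof.
move=> Gm GI GT p12; apply: (g_sigma_algebra_measure_unique G Gm (fun=> setT)) => //.
  by rewrite bigcup_const//; exists 0%N.
by move=> k; rewrite ltey_eq fin_num_measure.
Qed.

Lemma pa_lt {n : nat} (E : rel 'I_n) (hE : sorted_dag E) i j :
  j \in pa E i -> (j < i)%N.
Proof. by rewrite inE; exact: hE. Qed.

(** * Solutions of the structural equations *)

Section structural_equations.
Context {R : realType} {n : nat} (E : rel 'I_n).
Context {TX TY : 'I_n -> ptopologicalType}.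
Hypothesis hE : sorted_dag E.
Notation PX := (DProd TX).
Notation PY := (DProd TY).
Notation Om := (PX * PY)%type.
Context {d : measure_display} {Omega : measurableType d}.
Variables (P : probability Omega R) (X : Omega -> PX) (Y : Omega -> PY)
  (U : 'I_n -> Omega -> R)
  (g : forall i : 'I_n, (Borel (TX i) * DProd (fam TX (pa E i)) *
     DProd (fam TY (pa E i)) * R)%type -> Borel (TY i)).
Hypotheses (mX : measurable_fun setT X) (mU : forall i, measurable_fun setT (U i))
  (indep : forall (A : set PX) (B : 'I_n -> set R), measurable A ->
     (forall i, measurable (B i)) ->
     P (X @^-1` A `&` \bigcap_i (U i @^-1` B i)) =
     (P (X @^-1` A) * \prod_(i < n) P (U i @^-1` B i))%E)
  (mg : forall i, measurable_fun setT (g i))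
  (Yg : forall i w, Y w i = g i (X w i, dsub (pa E i) (X w),
                                 dsub (pa E i) (Y w), U i w)).

Let XY (w : Omega) : Om := (X w, Y w).

(** A pi-system generating the sigma-algebra of X and the U_i with i < k. Keeping a full family B
    with trivial entries from k on lets the joint independence formula apply unchanged. *)
Let past (k : nat) : set (set Omega) := [set F | exists A (B : 'I_n -> set R),
  [/\ measurable A, (forall i, measurable (B i)),
      (forall i : 'I_n, (k <= i)%N -> B i = setT) &
      F = X @^-1` A `&` \bigcap_i (U i @^-1` B i)]].

Let past_measurable k : past k `<=` measurable.
Proof.
move=> _ [A [B [mA mB _ ->]]]; apply: measurableI.
  exact: (measurable_preimage mX).
apply: fin_bigcap_measurable; first exact: finite_finset.
by move=> i _; exact: (measurable_preimage (mU i)).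
Qed.

Let past_setI k : setI_closed (past k).
Proof.
move=> _ _ [A [B [mA mB Bk ->]]] [A' [B' [mA' mB' B'k ->]]].
exists (A `&` A'), (fun i => B i `&` B' i); split.
- exact: measurableI.
- by move=> i; exact: measurableI.
- by move=> i ki; rewrite Bk// B'k// setIT.
- by rewrite setIACA -bigcapI.
Qed.

Let past_U_indep (k : 'I_n) (C : set R) : measurable C ->
  forall F, <<s past k >> F ->
  P (F `&` U k @^-1` C) = (P F * P (U k @^-1` C))%E.
Proof.
move=> mC F GF; have mUC := measurable_preimage (mU k) mC.
have PC : ((fine (P (U k @^-1` C)))%:E = P (U k @^-1` C))%E.
  by rewrite fineK// fin_num_measure.
have intc D : measurable D ->
    (\int[P]_(w in D) (fine (P (U k @^-1` C)))%:E = P (U k @^-1` C) * P D)%E.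
  by move=> mD; rewrite PC integral_cst.
rewrite setIC muleC -intc; last exact: sigma_le_measurable GF.
move: F GF; apply: (@version_pi_lambda _ _ _ P _ _ (cst (fine (P (U k @^-1` C))))) => //.
- by move=> w /=; rewrite -!lee_fin PC measure_ge0 probability_le1.
- by rewrite intc// -[LHS]mule1; congr (_ * _)%E; exact/esym/probability_setT.
move=> _ [A [B [mA mB Bk ->]]].
have mF : measurable (X @^-1` A `&` \bigcap_i (U i @^-1` B i)).
  by apply: (past_measurable k); exists A, B.
rewrite intc//.
rewrite (_ : _ `&` _ = X @^-1` A `&` \bigcap_i (U i @^-1` (if i == k then C else B i))).
  rewrite indep//; last by move=> i; case: ifP.
  rewrite indep// (bigD1 k)//= [in RHS](bigD1 k)//= eqxx Bk// preimage_setT.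
  rewrite [P setT]probability_setT mul1e muleCA; congr (_ * (_ * _))%E.
  by apply: eq_bigr => i /negbTE ->.
apply/seteqP; split=> w /=.
  move=> [Cw [Aw h]]; split=> // i _ /=; case: eqP => [->//|_]; exact: h.
move=> [Aw h]; split; first by have := h k Logic.I; rewrite /= eqxx.
split=> // i _; have := h i Logic.I; rewrite /=; case: eqP => // -> _.
by rewrite Bk.
Qed.

Let past_X k : smeas (past k) X.
Proof.
move=> A mA; apply: sub_sigma_algebra; exists A, (fun=> setT); split=> //.
by apply/seteqP; split=> w //= [].
Qed.

Let past_Xi k i : smeas (past k) (fun w => (X w i : Borel (TX i))).
Proof.
exact: (smeas_comp _ X _ (measurable_dprod_coord TX i) (past_X k)).
Qed.

Let past_XS k S : smeas (past k) (fun w => dsub S (X w)).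
Proof. exact: (smeas_comp _ X _ (measurable_dsub S) (past_X k)). Qed.

Let past_U k (i : 'I_n) : (i < k)%N -> smeas (past k) (U i).
Proof.
move=> ik C mC; apply: sub_sigma_algebra.
exists setT, (fun j => if j == i then C else setT); split=> //.
- by move=> j; case: ifP.
- by move=> j kj; case: eqP => // ji; move: kj; rewrite ji leqNgt ik.
apply/seteqP; split=> w /=.
  by move=> Cw; split=> // j _ /=; case: eqP => [->|].
by move=> [_ /(_ i Logic.I)]; rewrite /= eqxx.
Qed.

(** Measurability of [Y] is not assumed here. It comes from the equations by strong induction,
    because parents have smaller indices. *)
Let past_Y k (i : 'I_n) : (i < k)%N -> smeas (past k) (fun w => (Y w i : Borel (TY i))).
Proof.
have [N] := ubnP i; elim: N i => // N IHN i iN ik.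
have -> : (fun w => (Y w i : Borel (TY i))) =
    g i \o (fun w => (X w i, dsub (pa E i) (X w), dsub (pa E i) (Y w), U i w)).
  by apply/funext => w; rewrite /= Yg.
apply: smeas_comp => //; apply: smeas_pair; last exact: past_U.
apply: smeas_pair.
  by apply: smeas_pair; [exact: past_Xi|exact: past_XS].
apply: smeas_dprod => -[j jpa]; have ji := pa_lt E hE _ _ jpa.
by apply: IHN; [exact: leq_trans ji iN|exact: ltn_trans ji ik].
Qed.

Lemma measurable_solution : measurable_fun setT XY.
Proof.
apply: (smeas_measurable (past n)); first exact: past_measurable.
apply: smeas_pair; first exact: past_X.
by apply: smeas_dprod => i; exact: past_Y.
Qed.

Let past_cyl (k : 'I_n) F : <<s cyl [set: 'I_n]%SET (lt_set k) >> F ->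
  <<s past k >> (XY @^-1` F).
Proof.
have mXY : measurable_fun (setT : set (g_sigma_algebraType (past k)))
    (XY : Omega -> g_sigma_algebraType (cyl [set: 'I_n]%SET (lt_set k))).
  apply: measurable_fun_generated => _ [[i _ [B mB ->]]|[i ik [B mB ->]]].
    exact: past_Xi.
  by apply: past_Y => //; rewrite inE in ik.
by move=> GF; rewrite -[_ @^-1` _]setTI; exact: (mXY measurableT).
Qed.

(** The noise U_k is independent of [past k], for which X and the earlier Y-coordinates are
    measurable; [indep_noise_cver] applies with [J] the identity onto that sigma-algebra. *)
Lemma structural_noise_law (k : 'I_n) (m : probability R R) (A : set (Borel (TY k)))
    (F : set Om) :
  (forall B, measurable B -> P (U k @^-1` B) = m B) ->
  measurable A -> <<s cyl [set: 'I_n]%SET (lt_set k) >> F ->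
  P (XY @^-1` (Yc k @^-1` A `&` F)) =
  (\int[P]_(w in XY @^-1` F) (noise_law m (g k) A (Zc E k (XY w)))%:E)%E.
Proof.
move=> Um mA GF.
have sZ : smeas (past k) (Zc E k \o XY).
  apply: smeas_pair.
    by apply: smeas_pair; [exact: past_Xi|exact: past_XS].
  apply: smeas_dprod => -[j jpa]; have ji := pa_lt E hE _ _ jpa.
  exact: past_Y.
have := @indep_noise_cver R _ _ _ _ _ _ m (g k) (mg k) _ _ _ _ P (sigid (past k))
  (U k) (Zc E k \o XY) A.
case=> //.
- by apply: measurable_sigid; exact: past_measurable.
- exact: smeas_fun.
- by move=> B C mB mC; rewrite past_U_indep// Um.
move=> _ _ /(_ _ (past_cyl k F GF)) <-; congr (P _).
by apply/seteqP; split=> w /=; rewrite /Yc /= Yg.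
Qed.

End structural_equations.

(** * Equivalence of (i) and (ii) *)

Section causal_cond2.
Context {R : realType} {n : nat} (E : rel 'I_n).
Context {TX TY : 'I_n -> ptopologicalType}.
Hypothesis hE : sorted_dag E.
Notation Om := (DProd TX * DProd TY)%type.
Variable pi : probability Om R.

Lemma causal_cond2 : G_causal E pi ->
  forall i, cind pi (cyl [set: 'I_n]%SET (lt_set i)) (Yc i) (Zc E i).
Proof.
move=> [d0 [Om0 [P [X [Y [U [g [[mXY law] [mX mU] indep mg Yg]]]]]]]] k A mA.
pose Um : {mfun Om0 >-> R} := HB.pack (U k) (isMeasurableFun.Build _ _ _ _ _ (mU k)).
(* The noise of a causal coupling may have any law; the conditional law of Y_k is expressed through
   that law. *)
pose m : probability R R := distribution P Um.
exists (noise_law m (g k) A); split.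
- exact: measurable_noise_law.
- by move=> z; exact: noise_law01.
move=> F GF; have mF := sigma_le_measurable (cyl_measurable _ _) _ GF.
have mZ : measurable_fun setT (Zc E k : Om -> _) by exact: measurable_Zc.
have mYA := measurable_preimage (measurable_Yc (TX := TX) (TY := TY) k) mA.
rewrite -law; last exact: measurableI.
rewrite (structural_noise_law E hE P X Y U g mX mU indep mg Yg k m)//.
transitivity (\int[pushforward P (fun w => (X w, Y w))]_(w in F)
    (noise_law m (g k) A (Zc E k w))%:E)%E.
  rewrite ge0_integral_pushforward//.
  - apply/measurable_EFinP/measurable_funTS; apply: measurableT_comp => //.
    exact: measurable_noise_law.
  - by move=> w _; rewrite lee_fin; case/andP: (noise_law01 m (g k) (mg k) A (Zc E k w) mA).
by apply: eq_measure_integral => B mB _; exact: law.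
Qed.

Lemma cond2_causal (mu : probability (DProd TX) R) :
  (forall i, polish R (TY i)) ->
  (forall A, measurable A -> pi (fst @^-1` A) = mu A) ->
  (forall i, cind pi (cyl [set: 'I_n]%SET (lt_set i)) (Yc i) (Zc E i)) ->
  G_causal E pi.
Proof.
move=> polY pi_mu c2; have [m unif] := uniform_exists R.
have mZ i : measurable_fun setT (Zc E i : Om -> _) by exact: measurable_Zc.
have hg i := outsourcing pi m _ (Yc i) unif (mZ i) (measurable_Yc i) (polY i).
pose g i := s2val (cid2 (hg i)).
have mg i : measurable_fun setT (g i) by rewrite /g; case: cid2.
have vg i A : measurable A ->
    cver pi (Zc E i) (Yc i @^-1` A) (noise_law m (g i) A).
  by rewrite /g; case: cid2 => ? ? h; exact: h.
have [d0 [Om0 [P [X [U [mX mU PX PU indep]]]]]] := @iid_noise_exists R n _ _ mu m.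
pose step (y : Om0 -> DProd TY) (w : Om0) : DProd TY := fun i =>
  g i (X w i, dsub (pa E i) (X w), dsub (pa E i) (y w), U i w).
(* Coordinate i reads only smaller coordinates of y and is settled after i + 1 iterations, so n
   iterations reach a fixed point of [step]. *)
pose Y := iter n step (fun=> point).
have stable k (i : 'I_n) w : (i < k)%N ->
    iter k step (fun=> point) w i = iter k.+1 step (fun=> point) w i.
  elim: k i => // k IHk i ik.
  apply: (congr1 (fun y => g i (X w i, dsub (pa E i) (X w), y, U i w))).
  apply: functional_extensionality_dep => -[j jpa].
  by rewrite /dsub /=; apply: IHk; exact: leq_trans (pa_lt E hE _ _ jpa) ik.
have Yg i w : Y w i = g i (X w i, dsub (pa E i) (X w), dsub (pa E i) (Y w), U i w).
  by rewrite /Y stable// iterS.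
have mXY := measurable_solution E hE X Y U g mX mU mg Yg.
exists d0, Om0, P, X, Y, U, g; split=> //; split=> //.
pose XYm : {mfun Om0 >-> Om} :=
  HB.pack (fun w => (X w, Y w)) (isMeasurableFun.Build _ _ _ _ _ mXY).
(* All of X is present from the start, and the Y-coordinates are added one at a time, since (ii)
   conditions Y_k on the whole of X. *)
suff law k : (k <= n)%N -> forall F, <<s cyl [set: 'I_n]%SET (below k) >> F ->
    distribution P XYm F = pi F.
  move=> A mA; apply: (law n (leqnn n)).
  have sid : smeas (cyl [set: 'I_n]%SET (below n)) (fun w : Om => (w.1, w.2)).
    apply: smeas_pair; first exact: smeas_fst.
    by apply: smeas_dprod => i; apply: smeas_Yc; rewrite inE ltn_ord.
  have := sid A mA; congr (<<s _ >> _).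
  by apply/seteqP; split=> -[].
elim: k => [_ F GF|k IHk kn].
  have [|D mD ->] := sigma_preimage (fst : Om -> DProd TX) _ measurable _ F GF.
    move=> F' [[i _ [B mB ->]]|[i]]; last by rewrite inE.
    exists ((fun x : DProd TX => (x i : Borel (TX i))) @^-1` B) => //.
    apply: sub_sigma_algebra; exact: (measurable_preimage (measurable_dprod_coord TX i)).
  have mD' : measurable D.
    by move: D mD; apply: sigma_le_measurable.
  by rewrite pi_mu// -PX.
pose j : 'I_n := Ordinal kn.
pose G1 : set (set Om) := cyl [set: 'I_n]%SET (lt_set j).
pose Q : set (set Om) := [set F | exists F1 A, [/\ <<s G1 >> F1, measurable A &
  F = Yc j @^-1` A `&` F1]].
have mYc := measurable_Yc (TX := TX) (TY := TY) j.
have G1T : <<s G1 >> setT by exact: (@measurableT _ (g_sigma_algebraType G1)).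
have G2Q : cyl [set: 'I_n]%SET (below k.+1) `<=` <<s Q >>.
  move=> F [FX|[i]].
    apply: sub_sigma_algebra; exists F, setT; split=> //.
      by apply: sub_sigma_algebra; left.
    by rewrite preimage_setT setTI.
  rewrite inE ltnS leq_eqVlt => /orP[/eqP ik|ik] FB.
    apply: sub_sigma_algebra; have ij : i = j by exact/val_inj.
    by move: FB; rewrite ij => -[B mB ->]; exists setT, B; split=> //; rewrite setIT.
  apply: sub_sigma_algebra; exists F, setT; split=> //.
    by apply: sub_sigma_algebra; right; exists i => //; rewrite inE.
  by rewrite preimage_setT setTI.
move=> F /(sigma_le G2Q).
apply: (probability_pi_system_unique (distribution P XYm) pi).
- move=> _ [F1 [A [GF1 mA ->]]]; apply: measurableI.
    exact: (measurable_preimage mYc).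
  exact: (sigma_le_measurable (cyl_measurable _ _)) GF1.
- move=> _ _ [F1 [A [GF1 mA ->]]] [F1' [A' [GF1' mA' ->]]].
  exists (F1 `&` F1'), (A `&` A'); split.
  + exact: (@measurableI _ (g_sigma_algebraType G1)).
  + exact: measurableI.
  + by rewrite preimage_setI setIACA.
- by exists setT, setT; split=> //; rewrite preimage_setT setIT.
move=> {}F [F1 [A [GF1 mA ->]]].
have sZ : smeas G1 (Zc E j : Om -> _).
  by apply: smeas_Zc; rewrite ?finset.in_setT ?finset.subsetT// pa_sub_lt.
rewrite (cind_version pi _ _ _ _ _ (cyl_measurable _ _) sZ (c2 j) mA (vg j A mA))//.
rewrite [LHS](structural_noise_law E hE P X Y U g mX mU indep mg Yg j m)//; last first.
  by move=> B mB; exact: PU.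
(* The integrand is regarded as a function on the smaller sigma-algebra, since the induction
   hypothesis identifies the two laws only there. *)
pose h : g_sigma_algebraType G1 -> \bar R :=
  fun w => (noise_law m (g j) A (Zc E j w))%:E.
have mh : measurable_fun setT h.
  apply/measurable_EFinP; apply: measurableT_comp; first exact: measurable_noise_law.
  exact: smeas_fun.
have h0 w : (0 <= h w)%E.
  by rewrite lee_fin; case/andP: (noise_law01 m (g j) (mg j) A (Zc E j w) mA).
have mI := measurable_sigid G1 (cyl_measurable _ _).
have mIXY := measurableT_comp mI mXY.
transitivity (\int[pushforward P (sigid G1 \o (fun w => (X w, Y w)))]_(w in F1) h w)%E.
  by rewrite ge0_integral_pushforward//; exact: measurable_funTS.
transitivity (\int[pushforward pi (sigid G1)]_(w in F1) h w)%E; last first.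
  by rewrite ge0_integral_pushforward//; exact: measurable_funTS.
apply: eq_measure_integral => B mB _; exact: (IHk (ltnW kn)).
Qed.

End causal_cond2.

(** * The four conditions combined *)

Theorem mainTheorem2 (R : realType) (n : nat) (E : rel 'I_n)
  (TX TY : 'I_n -> ptopologicalType)
  (polX : forall i, polish R (TX i)) (polY : forall i, polish R (TY i))
  (hE : sorted_dag E)
  (mu : probability (DProd TX) R) (nu : probability (DProd TY) R)
  (pi : probability (DProd TX * DProd TY)%type R)
  (hmu : G_compatible E mu) (hpi : coupling mu nu pi) :
  let X_ (i : 'I_n) := fun w : (DProd TX * DProd TY)%type => (w.1 i : Borel (TX i)) in
  let Y_ (i : 'I_n) := fun w : (DProd TX * DProd TY)%type => (w.2 i : Borel (TY i)) in
  let XS (S : {set 'I_n}) := fun w : (DProd TX * DProd TY)%type => dsub S w.1 in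
  let YS (S : {set 'I_n}) := fun w : (DProd TX * DProd TY)%type => dsub S w.2 in
  (* (i) *)
  let cond1 := G_causal E pi in
  (* (ii) *)
  let cond2 := forall i : 'I_n,
      cond_indep pi (Y_ i) (fun w => (w.1, YS (lt_set i) w))
                     (fun w => (X_ i w, XS (pa E i) w, YS (pa E i) w)) in
  (* (iii) *)
  let cond3 := forall i : 'I_n,
      cond_indep pi (X_ i) (fun w => (XS (lt_set i) w, YS (lt_set i) w))
                     (XS (pa E i)) /\
      cond_indep pi (Y_ i) (fun w => (XS (le_set i) w, YS (lt_set i) w))
                     (fun w => (X_ i w, XS (pa E i) w, YS (pa E i) w)) in
  (* (iv) *)
  let cond4 :=
      (* pi is jointly G-compatible *)
      (forall i : 'I_n, (0 < i)%N ->
         cond_indep pi (fun w => (X_ i w, Y_ i w))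
                       (fun w => (XS (lt_set i) w, YS (lt_set i) w))
                       (fun w => (XS (pa E i) w, YS (pa E i) w))) /\
      (* pi(dx_i | x_pa, y_pa) = mu(dx_i | x_pa), pi-a.e. *)
      (forall (i : 'I_n)
         (kappa : (DProd (fam TX (pa E i)) * DProd (fam TY (pa E i)))%type ->
                  probability (Borel (TX i)) R)
         (lambda : DProd (fam TX (pa E i)) -> probability (Borel (TX i)) R),
         is_rcd pi (fun w => (XS (pa E i) w, YS (pa E i) w)) (X_ i) kappa ->
         is_rcd mu (dsub (pa E i)) (fun x : DProd TX => (x i : Borel (TX i))) lambda ->
         {ae pi, forall w, forall A : set (Borel (TX i)), measurable A ->
            kappa (XS (pa E i) w, YS (pa E i) w) A = lambda (XS (pa E i) w) A}) in
  [/\ cond1 <-> cond2, cond1 <-> cond3 & cond1 <-> cond4].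
Proof.
move=> X_ Y_ XS0 YS0 cond1 cond2 cond3 cond4.
have pi_mu A : measurable A -> pi (fst @^-1` A) = mu A.
  by move=> mA; rewrite -(hpi.1 A mA); congr (pi _); apply/seteqP; split=> w //= [].
have compat := compatible_cind E pi mu pi_mu hmu.
pose c2 := forall i, cind pi (cyl [set: 'I_n]%SET (lt_set i)) (Yc i) (Zc E i).
pose c3X := forall i, cind pi (cyl (lt_set i) (lt_set i)) (Xc i) (XS (pa E i)).
pose c3Y := forall i, cind pi (cyl (le_set i) (lt_set i)) (Yc i) (Zc E i).
have e12 : cond1 <-> c2.
  by split; [exact: causal_cond2|exact: (cond2_causal E hE pi mu polY pi_mu)].
have e2 : cond2 <-> c2.
  by split=> h i; apply/(cond2P E hE pi i); exact: h.
have e3 : cond3 <-> c3X /\ c3Y.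
  split=> [h|[hX hY] i].
    by split=> i; [apply/(cond3XP E hE pi i)|apply/(cond3YP E hE pi i)]; case: (h i).
  by split; [apply/(cond3XP E hE pi i); exact: hX|apply/(cond3YP E hE pi i); exact: hY].
have e23 : c2 <-> c3X /\ c3Y.
  split=> [h|[hX hY]]; last exact: cond3_cond2.
  split; first exact: cond2_cond3X.
  by move=> i; apply: cindS (h i); apply: cyl_sigmaS => //; exact: finset.subsetT.
have e34 : c3X /\ c3Y <-> cond4.
  split=> [[hX hY]|[joint kernels]].
    split=> [i _|i]; first exact: (cond3_cond4 E hE pi i (hX i) (hY i)).
    exact: (cond3X_kernels E polX hE pi mu pi_mu i (hX i)).
  have jc i : cind pi (cyl (lt_set i) (lt_set i)) (fun w => (Xc i w, Yc i w)) (Zp E i).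
    (* Joint compatibility is stated for positive indices; at index 0 the past is empty and the
       condition holds trivially. *)
    have [i0|i0] := posnP i; last by apply/(cond4P E hE pi i); exact: joint.
    apply: cind_trivial.
      by move=> F [[j]|[j]]; rewrite inE i0.
    by apply: measurable_fun_pair; [exact: measurable_Xc|exact: measurable_Yc].
  split=> i.
    exact: (cond4_cond3X E polX hE pi mu i (jc i) (kernels i)).
  by apply: (cond4_cond3Y E pi i); apply/(cond4P E hE pi i); exact: jc.
by split; [rewrite e2|rewrite e3 -e23|rewrite -e34 -e23].
Qed.
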